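(* Let $\ell,\nu,\chi,\delta>0$, let $N\ge 0$ be an integer, and let $\Omega=(0,\ell)^3$. Let $u_0=u_0(x)$ and $f=f(x)$ be smooth, $\ell$-periodic, divergence-free, mean-zero vector fields on $\mathbb{R}^3$ with values in $\mathbb{R}^3$, $f\not\equiv 0$. Let $u(x,t)$ be a mean-zero solution on $\Omega\times[0,\infty)$ of the Time Relaxation Model $$u_t+u\cdot\nabla u-\nu\Delta u+\nabla p+\chi\,(u-G_N\overline{u})=f(x),\qquad \nabla\cdot u=0,\qquad u(x,0)=u_0(x),$$ with periodic boundary conditions $u(x+\ell e_j,t)=u(x,t)$, $j=1,2,3$. Then the time-averaged energy dissipation rate satisfies $$\langle\varepsilon(u)\rangle\le\Big(2+\frac{1}{\mathcal{R}e}+\frac{1}{R_N}\Big)\frac{U^3}{L},$$ where $\mathcal{R}e=\dfrac{UL}{\nu}$, $R_N=\dfrac{U L^{2N+1}}{\chi\,\delta^{2N+2}}$, and the averaging operator, $G_N$, $\varepsilon$, $U$, $L$ and the notion of solution are as defined in the context.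
   Context: Norms: $\|\cdot\|$ and $(\cdot,\cdot)$ are the $L^2(\Omega)$ norm and inner product; $|\Omega|=\ell^3$; $\nabla f$ is the gradient tensor, with pointwise size $|\nabla f|$ measured by the Euclidean (Frobenius) norm. Filter and deconvolution: for an $\ell$-periodic $\phi\in L^2(\Omega)$, $\overline{\phi}=G\phi$ is the unique $\ell$-periodic solution of $-\delta^2\Delta\overline{\phi}+\overline{\phi}=\phi$, i.e. $G=(I-\delta^2\Delta)^{-1}$ (applied componentwise to vector fields). The $N$th van Cittert approximate deconvolution operator is $G_N=\sum_{n=0}^{N}(I-G)^n$. The operator $I-G_NG$ is self-adjoint and nonnegative on periodic $L^2(\Omega)$, and $B:=\delta^{-(N+1)}\sqrt{I-G_NG}$, so that $(\phi-G_N\overline{\phi},\phi)=\delta^{2N+2}\|B\phi\|^2$. Solution: $u$ is a weak solution on $[0,\infty)$: for every $T>0$, $u\in L^\infty(0,T;L^2(\Omega))\cap L^2(0,T;H^1(\Omega))$, $u$ is $\ell$-periodic, divergence-free, mean-zero ($\int_\Omega u\,dx=0$) and weakly continuous in time with values in $L^2(\Omega)$, $u(0)=u_0$, the equation holds in the distributional sense against smooth periodic divergence-free test fields, and the energy inequality $$\tfrac12\|u(t)\|^2+\int_0^t\!\int_\Omega \nu|\nabla u|^2+\chi(u-G_N\overline{u})\cdot u\,dx\,dt'\le\tfrac12\|u_0\|^2+\int_0^t\!\int_\Omega f\cdot u\,dx\,dt'$$ holds for all $t\ge0$ (with equality when $u$ is a strong solution). Time average: $\langle\psi\rangle:=\limsup_{T\to\infty}\frac1T\int_0^T\psi(t)\,dt$.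 Energy dissipation rate: $\varepsilon=\varepsilon(u)(t):=\frac{1}{|\Omega|}\left(\nu\|\nabla u(t)\|^2+\chi\,\delta^{2N+2}\|Bu(t)\|^2\right)$. Scales: $$F:=\Big\langle\tfrac{1}{|\Omega|}\|f\|^2\Big\rangle^{1/2},\qquad U:=\Big\langle\tfrac{1}{|\Omega|}\|u\|^2\Big\rangle^{1/2},$$ $$L:=\min\Big\{|\Omega|^{1/3},\ \frac{F}{\langle\frac{1}{|\Omega|}\|\nabla f\|^2\rangle^{1/2}},\ \frac{F}{\|\nabla f\|_{L^\infty(\Omega)}},\ \frac{F^{\frac{1}{N+1}}}{\langle\frac{1}{|\Omega|}\|Bf\|^2\rangle^{\frac{1}{2N+2}}}\Big\}.$$ (Since $f$ is time-independent, the time averages of quantities depending only on $f$ are the quantities themselves.) *)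

(* Defs.v *)
From HB Require Import structures.
From mathcomp Require Import all_boot all_order all_algebra.
From mathcomp Require Import all_classical all_reals all_analysis.
Set Implicit Arguments.
Unset Strict Implicit.
Unset Printing Implicit Defensive.
Import Order.TTheory GRing.Theory Num.Theory.
Import numFieldNormedType.Exports.
Local Open Scope classical_set_scope.
Local Open Scope ring_scope.

(* Points of R^3 are triples, so that Lebesgue measure on R^3 is the library's
   product measure.  Vector fields are families of three scalar components, and
   operators on scalar functions act on them componentwise. *)
Definition leb1 (R : realType) : {measure set measurableTypeR R -> \bar R} :=
  @lebesgue_measure R.
Definition leb3 (R : realType) :
  {measure set (measurableTypeR R * measurableTypeR R * measurableTypeR R)
     -> \bar R} :=
  ((@lebesgue_measure R \x @lebesgue_measure R) \x @lebesgue_measure R)%E.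

Definition box (R : realType) (l : R) : set (R * R * R) :=
  (`]0, l[%classic `*` `]0, l[%classic) `*` `]0, l[%classic.

Definition axis (R : realType) (j : 'I_3) : R * R * R :=
  (((j == 0%N :> nat)%:R, (j == 1%N :> nat)%:R), (j == 2%N :> nat)%:R).

Definition partial (R : realType) (j : 'I_3) (g : R * R * R -> R) :
  R * R * R -> R := fun x => 'D_(axis R j) g x.

Definition laplacian (R : realType) (g : R * R * R -> R) : R * R * R -> R :=
  fun x => \sum_(j < 3) partial j (partial j g) x.

(* C^n through directional derivatives: on a finite-dimensional space, asking
   that all of them exist and be C^n is the usual definition of C^n.+1. *)
Fixpoint Cn (R : realType) (V : normedModType R) (n : nat) (g : V -> R) : Prop :=
  continuous g /\
  if n is m.+1 then
    forall v : V, (forall x, derivable g x v) /\ Cn m (fun x => 'D_v g x)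
  else True.

Definition smooth (R : realType) (V : normedModType R) (g : V -> R) : Prop :=
  forall n, Cn n g.

Definition periodic (R : realType) (l : R) (g : R * R * R -> R) : Prop :=
  forall j x, g (x + l *: axis R j) = g x.

Definition box_ip (R : realType) (l : R) (g h : R * R * R -> R) : R :=
  \int[leb3 R]_(x in box l) (g x * h x).

Definition vec_ip (R : realType) (l : R) (v w : 'I_3 -> R * R * R -> R) : R :=
  \sum_(i < 3) box_ip l (v i) (w i).

Definition vec_sqnorm (R : realType) (l : R) (v : 'I_3 -> R * R * R -> R) : R :=
  vec_ip l v v.

Definition ten_sqnorm (R : realType) (l : R)
    (A : 'I_3 -> 'I_3 -> R * R * R -> R) : R :=
  \sum_(i < 3) vec_sqnorm l (A i).

(* Elements of periodic L^2 are represented by everywhere defined, exactly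
   periodic, Borel functions; equality in L^2 is equality almost everywhere. *)
Definition L2per (R : realType) (l : R) (g : R * R * R -> R) : Prop :=
  [/\ measurable_fun setT g, periodic l g &
      (leb3 R).-integrable (box l) (fun x => (g x ^+ 2)%:E)].

Definition eq_box (R : realType) (l : R) (g h : R * R * R -> R) : Prop :=
  {ae leb3 R, forall x, box l x -> g x = h x}.

Definition weak_grad (R : realType) (l : R) (g : R * R * R -> R)
    (D : 'I_3 -> R * R * R -> R) : Prop :=
  forall psi : R * R * R -> R, smooth psi -> periodic l psi ->
  forall j, box_ip l g (partial j psi) = - box_ip l (D j) psi.

Definition H1per (R : realType) (l : R) (g : R * R * R -> R)
    (D : 'I_3 -> R * R * R -> R) : Prop :=
  [/\ L2per l g, forall j, L2per l (D j) & weak_grad l g D].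

(* g is the periodic (variational) solution of - delta^2 Laplacian g + g = phi *)
Definition helmholtz_solution (R : realType) (l delta : R)
    (phi g : R * R * R -> R) : Prop :=
  exists2 D, H1per l g D &
  forall psi Dpsi, H1per l psi Dpsi ->
    delta ^+ 2 * vec_ip l D Dpsi + box_ip l g psi = box_ip l phi psi.

(* G is determined up to almost everywhere equality. *)
Definition is_filter (R : realType) (l delta : R)
    (G : (R * R * R -> R) -> R * R * R -> R) : Prop :=
  forall phi, L2per l phi -> helmholtz_solution l delta phi (G phi).

Definition deconv (R : realType) (G : (R * R * R -> R) -> R * R * R -> R)
    (N : nat) (phi : R * R * R -> R) : R * R * R -> R :=
  fun x => \sum_(n < N.+1) iter n (fun psi => psi \- G psi) phi x.

Definition residual (R : realType) (G : (R * R * R -> R) -> R * R * R -> R)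
    (N : nat) (phi : R * R * R -> R) : R * R * R -> R :=
  phi \- deconv G N (G phi).

(* Q is the nonnegative self-adjoint square root of A on periodic L^2; being
   symmetric and everywhere defined, it is automatically linear and bounded. *)
Definition is_sqrt_op (R : realType) (l : R)
    (A Q : (R * R * R -> R) -> R * R * R -> R) : Prop :=
  [/\ forall phi, L2per l phi -> L2per l (Q phi),
      forall phi psi, L2per l phi -> L2per l psi ->
        box_ip l (Q phi) psi = box_ip l phi (Q psi),
      forall phi, L2per l phi -> 0 <= box_ip l (Q phi) phi &
      forall phi, L2per l phi -> eq_box l (Q (Q phi)) (A phi)].

(* The operator B, given the square root Q of the residual operator. *)
Definition scaled_sqrt (R : realType) (delta : R) (N : nat)
    (Q : (R * R * R -> R) -> R * R * R -> R) (phi : R * R * R -> R) :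
  R * R * R -> R := fun x => delta ^- N.+1 * Q phi x.

Definition gradient (R : realType) (v : 'I_3 -> R * R * R -> R) :
  'I_3 -> 'I_3 -> R * R * R -> R := fun i j => partial j (v i).

Definition frobenius (R : realType) (A : 'I_3 -> 'I_3 -> R * R * R -> R)
    (x : R * R * R) : R :=
  Num.sqrt (\sum_(i < 3) \sum_(j < 3) A i j x ^+ 2).

Definition divergence_free (R : realType) (v : 'I_3 -> R * R * R -> R) : Prop :=
  forall x, \sum_(i < 3) partial i (v i) x = 0.

Definition weakly_divergence_free (R : realType) (l : R)
    (v : 'I_3 -> R * R * R -> R) : Prop :=
  forall q : R * R * R -> R, smooth q -> periodic l q ->
  vec_ip l v (fun i => partial i q) = 0.

Definition mean_zero (R : realType) (l : R) (v : 'I_3 -> R * R * R -> R) :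
  Prop :=
  forall i, \int[leb3 R]_(x in box l) v i x = 0.

Definition smooth_data (R : realType) (l : R) (v : 'I_3 -> R * R * R -> R) :
  Prop :=
  [/\ forall i, smooth (v i), forall i, periodic l (v i),
      divergence_free v & mean_zero l v].

(* Smooth, periodic, divergence-free test fields on space-time, with compact
   support in the open half-line of positive times. *)
Definition test_field (R : realType) (l : R)
    (phi : R -> 'I_3 -> R * R * R -> R) : Prop :=
  [/\ forall i, smooth (fun p : R * (R * R * R) => phi p.1 i p.2),
      forall t i, periodic l (phi t i),
      forall t, divergence_free (phi t) &
      exists a b : R, 0 < a /\
        forall t i x, ~~ (a <= t <= b) -> phi t i x = 0].

(* The distributional form of the momentum equation tested against phi, all
   derivatives being moved to phi; u . grad u = div (u (x) u) since div u = 0. *)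
Definition momentum_pairing (R : realType) (l nu chi : R)
    (A : (R * R * R -> R) -> R * R * R -> R) (f : 'I_3 -> R * R * R -> R)
    (v : 'I_3 -> R * R * R -> R) (phi : R -> 'I_3 -> R * R * R -> R)
    (t : R) : R :=
  vec_ip l v (fun i x => derive1 (fun s => phi s i x) t)
  + (\sum_(i < 3) \sum_(j < 3)
       \int[leb3 R]_(x in box l) (v i x * v j x * partial j (phi t i) x))
  + nu * vec_ip l v (fun i => laplacian (phi t i))
  - chi * vec_ip l (fun i => A (v i)) (phi t)
  + vec_ip l f (phi t).

(* A weak solution u of the Time Relaxation Model on [0, +oo[, together with
   its weak spatial gradient Du; A is the operator I - G_N G. *)
Record weak_solution (R : realType) (l nu chi : R)
    (A : (R * R * R -> R) -> R * R * R -> R) (u0 f : 'I_3 -> R * R * R -> R)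
    (u : R -> 'I_3 -> R * R * R -> R)
    (Du : R -> 'I_3 -> 'I_3 -> R * R * R -> R) : Prop := WeakSolution {
  ws_measurable : forall i,
    measurable_fun [set p : R * (R * R * R) | 0 <= p.1]
      (fun p => u p.1 i p.2) ;
  ws_grad_measurable : forall i j,
    measurable_fun [set p : R * (R * R * R) | 0 <= p.1]
      (fun p => Du p.1 i j p.2) ;
  ws_L2per : forall (t : R) i, 0 <= t -> L2per l (u t i) ;
  ws_H1per : {ae leb1 R, forall t : R, 0 <= t -> forall i, H1per l (u t i) (Du t i)} ;
  ws_LinfL2 : forall T : R, 0 < T -> exists M : R,
    {ae leb1 R, forall t : R, 0 <= t <= T -> vec_sqnorm l (u t) <= M} ;
  ws_L2H1 : forall T : R, 0 < T ->
    (\int[leb1 R]_(t in `[0%R, T]) \int[leb3 R]_(x in box l)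
       (\sum_(i < 3) (u t i x ^+ 2 + \sum_(j < 3) Du t i j x ^+ 2))%R%:E
     < +oo)%E ;
  ws_divergence_free : forall t : R, 0 <= t -> weakly_divergence_free l (u t) ;
  ws_mean_zero : forall t : R, 0 <= t -> mean_zero l (u t) ;
  ws_weakly_continuous : forall w : 'I_3 -> R * R * R -> R,
    (forall i, L2per l (w i)) ->
    {within `[0, +oo[, continuous (fun t => vec_ip l (u t) w)} ;
  ws_initial : forall i, eq_box l (u 0 i) (u0 i) ;
  ws_momentum : forall phi, test_field l phi ->
    \int[leb1 R]_(t in `]0, +oo[)
      momentum_pairing l nu chi A f (u t) phi t = 0 ;
  ws_energy : forall t : R, 0 <= t ->
    2^-1 * vec_sqnorm l (u t)
    + \int[leb1 R]_(s in `[0, t])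
        (nu * ten_sqnorm l (Du s) + chi * vec_ip l (fun i => A (u s i)) (u s))
    <= 2^-1 * vec_sqnorm l u0 + \int[leb1 R]_(s in `[0, t]) vec_ip l f (u s) }.

Definition time_average (R : realType) (psi : R -> R) : \bar R :=
  limf_esup (fun T : R => (T^-1)%:E * \int[leb1 R]_(t in `[0%R, T]) (psi t)%:E)%E
    +oo%R.

(* |Omega| = l^3 *)
Definition dissipation (R : realType) (l nu chi delta : R) (N : nat)
    (B : (R * R * R -> R) -> R * R * R -> R)
    (v : 'I_3 -> R * R * R -> R) (Dv : 'I_3 -> 'I_3 -> R * R * R -> R) : R :=
  (l ^+ 3)^-1 * (nu * ten_sqnorm l Dv
    + chi * delta ^+ (2 * N + 2) * vec_sqnorm l (fun i => B (v i))).

Definition force_scale (R : realType) (l : R) (f : 'I_3 -> R * R * R -> R) : R :=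
  Num.sqrt ((l ^+ 3)^-1 * vec_sqnorm l f).

(* An extended real, as is the limit superior that defines it. *)
Definition velocity_scale (R : realType) (l : R)
    (u : R -> 'I_3 -> R * R * R -> R) : \bar R :=
  sqrte (time_average (fun t => (l ^+ 3)^-1 * vec_sqnorm l (u t))).

(* Averages in time of the stationary f are omitted. *)
Definition length_scale (R : realType) (l : R) (N : nat)
    (B : (R * R * R -> R) -> R * R * R -> R) (f : 'I_3 -> R * R * R -> R) : R :=
  let F := force_scale l f in
  Num.min (Num.min ((l ^+ 3) `^ 3^-1)
                   (F / Num.sqrt ((l ^+ 3)^-1 * ten_sqnorm l (gradient f))))
          (Num.min (F / fine 'N[leb3 R]_+oo[
                           EFin \o (frobenius (gradient f) \_ (box l))])
                   (F `^ N.+1%:R^-1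
                    / ((l ^+ 3)^-1 * vec_sqnorm l (fun i => B (f i)))
                        `^ (2 * N + 2)%:R^-1)).

(* Main.v *)
Require Import Defs.
From HB Require Import structures.
From mathcomp Require Import all_boot all_order all_algebra.
From mathcomp Require Import all_classical all_reals all_analysis.
From mathcomp Require Import measurable_realfun ess_sup_inf.
From mathcomp Require Import zify ring lra.
Set Implicit Arguments.
Unset Strict Implicit.
Unset Printing Implicit Defensive.
Import Order.TTheory GRing.Theory Num.Theory.
Import numFieldNormedType.Exports.
Local Open Scope classical_set_scope.
Local Open Scope ring_scope.

(** Write X(t) = ||u(t)||^2 and let W(t) be the dissipation rate times the volume.
    The energy inequality and Young's inequality with a free constant bound the
    mean of W over [0, T] by F times a root mean square velocity, up to O(1/T).
    Conversely, testing the momentum equation against theta(t) f(x), where theta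
    is a smooth approximation of the indicator of [0, T], and using
    (A u, f) = (Q u, Q f) for the residual operator A = Q^2, bounds F^2 by
    (F/L) <X> plus m F^2 (nu/L^2 + chi delta^(2N+2)/L^(2N+2)) / 2 plus <W>/(2m),
    for every m > 0.  With m = U/F the last term is absorbed by the first
    inequality, and the two together give
    <W> <= 2 U^3/L + nu U^2/L^2 + chi delta^(2N+2) U^2/L^(2N+2).

    Only weak continuity of u in time is available, so the measurability of
    t |-> ||Q u(t)||^2, on which the additivity of the time integrals rests, comes
    from lower semicontinuity. *)

(** Test fields have compact support in the open half-line of positive times, so [f] alone cannot be
    tested; this forces the factor [theta], whose slope and ramps must both be harmless after
    averaging. Stretching [exp(- 1/x)] by [k] makes the slope of order [1/k], at the price of ramps
    of length of order [k^2], negligible when [T] tends to infinity with [k] fixed. Hence the order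
    of choices: a speed [q > U], then [k], then [T]. Young's inequality with a free weight stands in
    for Cauchy-Schwarz in [L^2], so that no square root of a time average occurs and the limit
    superior [U] enters only through the bound of the averaged [X / |Omega|] by [q^2] for large [T].
    Absorbing the dissipation keeps one half of it; the doubling that follows is the origin of the 2
    in front of [U^3 / L]. A real integral takes a default value on functions that are not
    integrable, so each splitting of a time integral is preceded by integrability proofs. The cases
    [U = +oo], [U = 0] and [L = 0] are governed by the conventions of extended real arithmetic and
    are treated apart. *)

(** * Integration of real-valued functions *)

Section RealIntegral.
Context d (T : measurableType d) (R : realType) (mu : {measure set T -> \bar R}).
Variable D : set T.
Hypothesis mD : measurable D.
Implicit Types f g : T -> R.

Lemma integrable_EFinD f g : mu.-integrable D (EFin \o f) ->
  mu.-integrable D (EFin \o g) -> mu.-integrable D (EFin \o (fun x => f x + g x)).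
Proof. exact: integrableD. Qed.

Lemma integrable_EFinB f g : mu.-integrable D (EFin \o f) ->
  mu.-integrable D (EFin \o g) -> mu.-integrable D (EFin \o (fun x => f x - g x)).
Proof. by move=> fi gi; exact: (integrableB mD fi gi). Qed.

Lemma integrable_EFinZ c f : mu.-integrable D (EFin \o f) ->
  mu.-integrable D (EFin \o (fun x => c * f x)).
Proof. exact: (@integrableZl _ _ _ _ _ mD c). Qed.

Lemma integrable_EFin_sum (I : Type) (s : seq I) (F : I -> T -> R) :
  (forall i, mu.-integrable D (EFin \o F i)) ->
  mu.-integrable D (EFin \o (fun x => \sum_(i <- s) F i x)).
Proof.
move=> iF; elim: s => [|i s IHs].
  under eq_fun do rewrite big_nil; exact: integrable0.
by under eq_fun do rewrite big_cons; exact: integrable_EFinD.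
Qed.

Lemma le_integrable_EFin f g : measurable_fun D f ->
  (forall x, D x -> `|f x| <= g x) -> mu.-integrable D (EFin \o g) ->
  mu.-integrable D (EFin \o f).
Proof.
move=> mf fg; apply: le_integrable => //; first exact/measurable_EFinP.
by move=> x Dx /=; rewrite lee_fin (le_trans (fg _ Dx))// ler_norm.
Qed.

Lemma Rintegral_sum (I : Type) (s : seq I) (F : I -> T -> R) :
  (forall i, mu.-integrable D (EFin \o F i)) ->
  \int[mu]_(x in D) (\sum_(i <- s) F i x) = \sum_(i <- s) \int[mu]_(x in D) F i x.
Proof.
move=> iF; elim: s => [|i s IHs].
  by rewrite big_nil; under eq_Rintegral do rewrite big_nil; rewrite Rintegral_cst// mul0r.
rewrite big_cons -IHs -RintegralD//; last exact: integrable_EFin_sum.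
by apply: eq_Rintegral => x _; rewrite big_cons.
Qed.

Lemma EFin_Rintegral f : mu.-integrable D (EFin \o f) ->
  (\int[mu]_(x in D) f x)%:E = (\int[mu]_(x in D) (f x)%:E)%E.
Proof. by move=> fi; rewrite fineK//; exact: integrable_fin_num. Qed.

(** The difference [g - f] is nonnegative only almost everywhere; its positive part agrees with it
    almost everywhere and is nonnegative at every point. *)
Lemma ae_le_Rintegral f g : mu.-integrable D (EFin \o f) ->
  mu.-integrable D (EFin \o g) -> {ae mu, forall x, D x -> f x <= g x} ->
  \int[mu]_(x in D) f x <= \int[mu]_(x in D) g x.
Proof.
move=> fi gi fg; rewrite -subr_ge0 -RintegralB//.
have gfi : mu.-integrable D (EFin \o (fun x => g x - f x)).
  exact: integrable_EFinB.
have mgf := measurable_int _ gfi.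
rewrite /Rintegral (ae_eq_integral (fun x => (Num.max (g x - f x) 0)%:E))//.
- by apply: fine_ge0; apply: integral_ge0 => x _; rewrite lee_fin le_max lexx orbT.
- apply/measurable_EFinP; apply: measurable_funrpos.
  exact/measurable_EFinP.
- apply: filterS fg => x fgx Dx /=; congr EFin.
  by rewrite /Num.max ltNge subr_ge0 fgx.
Qed.

Lemma integrable_EFin_cst c : (mu D < +oo)%E -> mu.-integrable D (EFin \o cst c).
Proof.
move=> muD; apply/integrableP; split; first exact/measurable_EFinP.
by rewrite /= integral_cst// lte_mul_pinfty.
Qed.

End RealIntegral.

(** * Lebesgue measure on space *)

Local Notation space R :=
  (measurableTypeR R * measurableTypeR R * measurableTypeR R)%type.

Section SpaceMeasure.
Context (R : realType).

Lemma leb3_cube_lty (a b : R) :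
  (leb3 R ((`]a, b[ `*` `]a, b[) `*` `]a, b[) < +oo)%E.
Proof.
have mI : measurable (`]a, b[%classic : set (measurableTypeR R)).
  exact: measurable_itv.
have I : (@lebesgue_measure R `]a, b[ < +oo)%E.
  by rewrite lebesgue_measure_itv /=; case: ifPn => // _; rewrite -EFinB ltry.
apply: (@le_lt_trans _ _ ((@lebesgue_measure R `]a, b[ *
    @lebesgue_measure R `]a, b[) * @lebesgue_measure R `]a, b[)%E).
  by rewrite -product_measure1E// -product_measure1E//; exact: measurableX.
have fI : @lebesgue_measure R `]a, b[ \is a fin_num by rewrite ge0_fin_numE.
by apply: lte_mul_pinfty => //; rewrite ?mule_ge0// ?fin_numM// lte_mul_pinfty.
Qed.

(** The open cubes of half-side [n] exhaust space. Tonelli's theorem, which makes box integrals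
    measurable in time, asks for this property. *)
Lemma leb3_sigma_finite : sigma_finite setT (leb3 R).
Proof.
pose I n : set R := `](- n%:R), n%:R[%classic.
exists (fun n => (I n `*` I n) `*` I n).
  apply/esym/seteqP; split=> // -[[x y] z] _.
  pose m := Num.max (Num.max `|x| `|y|) `|z|.
  have m0 : 0 <= m by rewrite /m !le_max normr_ge0.
  exists (Num.bound m) => //; have := archi_boundP m0.
  rewrite !gt_max -andbA => /and3P[].
  by rewrite !ltr_norml => hx hy hz; split; [split|]; rewrite /I/= in_itv.
move=> n; split; last exact: leb3_cube_lty.
by apply: measurableX; [apply: measurableX|]; exact: measurable_itv.
Qed.

(* The canonical sigma-finite structure on product measures is shadowed in the
   library by the one on products of subprobabilities. *)
Definition leb3_function : set (space R) -> \bar R := leb3 R.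

HB.instance Definition _ := isMeasure.Build _ _ _ leb3_function
  (measure0 (leb3 R)) (measure_ge0 (leb3 R))
  (@measure_semi_sigma_additive _ _ _ (leb3 R)).

HB.instance Definition _ :=
  Measure_isSigmaFinite.Build _ _ _ leb3_function leb3_sigma_finite.

End SpaceMeasure.

(** * Inner products and Young's inequality on periodic [L^2] *)

Section PeriodicL2.
Context {R : realType} (l : R).
Implicit Types (g h : R * R * R -> R) (v w : 'I_3 -> R * R * R -> R).

Lemma measurable_box : measurable (box l : set (space R)).
Proof. by apply: measurableX; [apply: measurableX|]; exact: measurable_itv. Qed.
Local Hint Resolve measurable_box : core.

Lemma leb3_box_lty : (leb3 R (box l) < +oo)%E.
Proof. exact: leb3_cube_lty. Qed.

Lemma L2per_measurable g : L2per l g -> measurable_fun (box l : set (space R)) g.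
Proof. by case=> mg _ _; apply: measurable_funS mg. Qed.

Lemma L2perM_integrable g h : L2per l g -> L2per l h ->
  (leb3 R).-integrable (box l) (EFin \o (fun x => g x * h x)).
Proof.
move=> Lg Lh; have [_ _ ig] := Lg; have [_ _ ih] := Lh.
apply: (le_integrable_EFin _ _ _ (integrable_EFinD _ ig ih)) => //.
  by apply: measurable_funM; exact: L2per_measurable.
move=> x _; have := sqr_ge0 (g x - h x); have := sqr_ge0 (g x + h x).
by rewrite ler_norml !expr2 => ? ?; apply/andP; split; nra.
Qed.

Lemma L2perD g h : L2per l g -> L2per l h -> L2per l (fun x => g x + h x).
Proof.
move=> Lg Lh; have [mg pg ig] := Lg; have [mh ph ih] := Lh; split.
- exact: measurable_funD.
- by move=> j x; rewrite pg ph.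
- apply: (eq_integrable measurable_box
    (EFin \o (fun x => g x ^+ 2 + h x ^+ 2 + 2 * (g x * h x)))).
    by move=> x _ /=; congr EFin; ring.
  apply: integrable_EFinD => //; first exact: integrable_EFinD.
  by apply: integrable_EFinZ => //; exact: L2perM_integrable.
Qed.

Lemma L2perZ c g : L2per l g -> L2per l (fun x => c * g x).
Proof.
move=> [mg pg ig]; split.
- exact: measurable_funM.
- by move=> j x; rewrite pg.
- apply: (eq_integrable measurable_box (EFin \o (fun x => c ^+ 2 * g x ^+ 2))).
    by move=> x _ /=; rewrite exprMn.
  exact: integrable_EFinZ.
Qed.

Lemma L2per0 : L2per l (cst 0).
Proof.
split=> //; rewrite [X in _.-integrable _ X](_ : _ = cst 0%E).
  exact: integrable0.
by apply/funext => x /=; rewrite expr0n.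
Qed.

Lemma L2per_sum (I : Type) (s : seq I) (F : I -> R * R * R -> R) :
  (forall i, L2per l (F i)) -> L2per l (fun x => \sum_(i <- s) F i x).
Proof.
move=> LF; elim: s => [|i s IHs].
  by under eq_fun do rewrite big_nil; exact: L2per0.
by under eq_fun do rewrite big_cons; exact: L2perD.
Qed.

Lemma box_ipC g h : box_ip l g h = box_ip l h g.
Proof. by apply: eq_Rintegral => x _; rewrite mulrC. Qed.

Lemma box_ip_ge0 g : 0 <= box_ip l g g.
Proof. by apply: Rintegral_ge0 => x _; rewrite -expr2 sqr_ge0. Qed.

Lemma box_ipDl g1 g2 h : L2per l g1 -> L2per l g2 -> L2per l h ->
  box_ip l (fun x => g1 x + g2 x) h = box_ip l g1 h + box_ip l g2 h.
Proof.
move=> L1 L2 Lh; rewrite /box_ip -RintegralD//; try exact: L2perM_integrable.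
by apply: eq_Rintegral => x _; rewrite mulrDl.
Qed.

Lemma box_ipZl c g h : L2per l g -> L2per l h ->
  box_ip l (fun x => c * g x) h = c * box_ip l g h.
Proof.
move=> Lg Lh; rewrite /box_ip -RintegralZl//; last exact: L2perM_integrable.
by apply: eq_Rintegral => x _; rewrite mulrA.
Qed.

Lemma box_ipDr g h1 h2 : L2per l g -> L2per l h1 -> L2per l h2 ->
  box_ip l g (fun x => h1 x + h2 x) = box_ip l g h1 + box_ip l g h2.
Proof. by move=> ? ? ?; rewrite box_ipC box_ipDl// ![box_ip _ g _]box_ipC. Qed.

Lemma box_ipZr c g h : L2per l g -> L2per l h ->
  box_ip l g (fun x => c * h x) = c * box_ip l g h.
Proof. by move=> ? ?; rewrite box_ipC box_ipZl// box_ipC. Qed.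

Lemma box_ip_sumr (I : Type) (s : seq I) g (F : I -> R * R * R -> R) :
  L2per l g -> (forall i, L2per l (F i)) ->
  box_ip l g (fun x => \sum_(i <- s) F i x) = \sum_(i <- s) box_ip l g (F i).
Proof.
move=> Lg LF; rewrite /box_ip -Rintegral_sum//.
  by apply: eq_Rintegral => x _; rewrite mulr_sumr.
by move=> i; exact: L2perM_integrable.
Qed.

Lemma box_ip_eq_box g g' h : L2per l g -> L2per l g' -> L2per l h ->
  eq_box l g g' -> box_ip l g h = box_ip l g' h.
Proof.
move=> Lg Lg' Lh gg'; rewrite /box_ip /Rintegral; congr fine.
apply: ae_eq_integral => //; try exact: measurable_int (L2perM_integrable _ _).
by apply: (@filterS _ _ (ae_filter_ringOfSetsType (leb3 R))) gg' => x /[apply] ->.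
Qed.

(** Expansion of [||k g - h||^2 >= 0], divided by [k]. *)
Lemma box_ip_young (k : R) g h : 0 < k -> L2per l g -> L2per l h ->
  box_ip l g h <= 2^-1 * (k * box_ip l g g + k^-1 * box_ip l h h).
Proof.
move=> k0 Lg Lh.
have := box_ip_ge0 (fun x => k * g x + -1 * h x).
have LZ := L2perZ k Lg; have Lm := L2perZ (-1) Lh.
have LD := L2perD LZ Lm.
rewrite box_ipDl// !box_ipDr// !box_ipZl// !box_ipZr//.
rewrite (box_ipC h g) => ge0.
rewrite -(ler_pM2l k0).
suff : 2 * (k * box_ip l g h) <= k * (k * box_ip l g g) + (k * k^-1) * box_ip l h h.
  by move=> ?; nra.
by rewrite divff ?gt_eqF//; nra.
Qed.

Lemma vec_ipC v w : vec_ip l v w = vec_ip l w v.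
Proof. by apply: eq_bigr => i _; rewrite box_ipC. Qed.

Lemma vec_sqnorm_ge0 v : 0 <= vec_sqnorm l v.
Proof. by apply: sumr_ge0 => i _; exact: box_ip_ge0. Qed.

Lemma vec_ip_young (k : R) v w : 0 < k -> (forall i, L2per l (v i)) ->
  (forall i, L2per l (w i)) ->
  vec_ip l v w <= 2^-1 * (k * vec_sqnorm l v + k^-1 * vec_sqnorm l w).
Proof.
move=> k0 Lv Lw; rewrite /vec_sqnorm /vec_ip !mulr_sumr -big_split mulr_sumr.
by apply: ler_sum => i _; exact: box_ip_young.
Qed.

Lemma vec_ipZr c v w : (forall i, L2per l (v i)) -> (forall i, L2per l (w i)) ->
  vec_ip l v (fun i x => c * w i x) = c * vec_ip l v w.
Proof.
by move=> Lv Lw; rewrite /vec_ip mulr_sumr; apply: eq_bigr => i _; rewrite box_ipZr.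
Qed.

Lemma vec_ip_young_abs v w : (forall i, L2per l (v i)) ->
  (forall i, L2per l (w i)) ->
  `|vec_ip l v w| <= 2^-1 * (vec_sqnorm l v + vec_sqnorm l w).
Proof.
move=> Lv Lw; have := vec_ip_young ltr01 Lv Lw.
have := vec_ip_young ltr01 Lv (fun i => L2perZ (-1) (Lw i)).
rewrite /vec_sqnorm !vec_ipZr//; last by move=> i; exact: L2perZ.
rewrite (vec_ipC (fun i x => -1 * w i x)) vec_ipZr// invr1 !mul1r !mulN1r opprK.
by rewrite ler_norml => ? ?; apply/andP; split; lra.
Qed.

End PeriodicL2.
#[local] Hint Resolve measurable_box : core.

(** * Calculus of [C^n] functions and a flat smooth function *)

Section SmoothFunctions.
Context {R : realType}.

Lemma Cn_continuous (V : normedModType R) n (g : V -> R) : Cn n g -> continuous g.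
Proof. by case: n => [|n] []. Qed.

Lemma CnW (V : normedModType R) n (g : V -> R) : Cn n.+1 g -> Cn n g.
Proof.
elim: n g => [|n IHn] g [cg dg]; split=> // v; have [dgv Cgv] := dg v.
by split=> //; exact: IHn.
Qed.

Lemma Cn_cst (V : normedModType R) n (c : R) : Cn n (cst c : V -> R).
Proof.
elim: n c => [|n IHn] c; split=> //; try exact: cst_continuous.
move=> v; split=> [x|]; first exact: derivable_cst.
by under eq_fun do rewrite derive_cst; exact: IHn.
Qed.

Lemma CnD (V : normedModType R) n (g h : V -> R) :
  Cn n g -> Cn n h -> Cn n (fun x => g x + h x).
Proof.
elim: n g h => [|n IHn] g h Cg Ch.
  by split=> // x; apply: continuousD; apply: Cn_continuous; eassumption.
split; first by move=> x; apply: continuousD; apply: Cn_continuous; eassumption.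
move=> v; have [dg Dg] := Cg.2 v; have [dh Dh] := Ch.2 v; split=> [x|].
  exact: derivableD.
under eq_fun do rewrite (deriveD (dg _) (dh _)).
exact: IHn.
Qed.

Lemma CnM (V : normedModType R) n (g h : V -> R) :
  Cn n g -> Cn n h -> Cn n (fun x => g x * h x).
Proof.
elim: n g h => [|n IHn] g h Cg Ch.
  by split=> // x; apply: continuousM; apply: Cn_continuous; eassumption.
split; first by move=> x; apply: continuousM; apply: Cn_continuous; eassumption.
move=> v; have [dg Dg] := Cg.2 v; have [dh Dh] := Ch.2 v; split=> [x|].
  exact: derivableM.
under eq_fun do rewrite (deriveM (dg _) (dh _)).
by apply: CnD; apply: IHn => //; exact: CnW.
Qed.

Lemma derive_affine (V W : normedModType R) (L L' : W -> V) (g : V -> R) x v :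
  (forall h, L (h *: v + x) = h *: L' v + L x) ->
  'D_v (g \o L) x = 'D_(L' v) g (L x).
Proof. by move=> LL'; rewrite /derive/=; under eq_fun do rewrite LL'. Qed.

(** The derivative of [g \o L] along [v] is the derivative of [g] along [L' v], composed with the
    same [L], so the induction closes. Rescalings of time and the two projections of space-time are
    instances. *)
Lemma Cn_affine (V W : normedModType R) n (L L' : W -> V) (g : V -> R) :
  continuous L -> (forall h v x, L (h *: v + x) = h *: L' v + L x) ->
  Cn n g -> Cn n (g \o L).
Proof.
move=> cL LL'; elim: n g => [|n IHn] g Cg.
  split=> // x; apply: continuous_comp; first exact: cL.
  exact: (Cn_continuous Cg).
split.
  by move=> x; apply: continuous_comp; [exact: cL|exact: (Cn_continuous Cg)].
move=> v; have [dg Dg] := Cg.2 (L' v); split=> [x|].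
  by have := dg (L x); rewrite /derivable/=; under [in X in _ -> X]eq_fun do rewrite LL'.
under eq_fun do rewrite (derive_affine (L' := L'))//.
exact: (IHn _ Dg).
Qed.

Lemma Cn_shift_scale n (a b : R) (g : R -> R) :
  Cn n g -> Cn n (fun t => g (a * t + b)).
Proof.
move=> Cg; apply: (Cn_affine (L := fun t : R => a * t + b) (L' := fun t : R => a * t)) Cg.
  move=> x; apply: cvgD; last exact: cvg_cst.
  by apply: cvgM; [exact: cvg_cst|exact: cvg_id].
by move=> h v x; rewrite /GRing.scale/=; ring.
Qed.

Lemma Cn_fst (V W : normedModType R) n (g : V -> R) :
  Cn n g -> Cn n (fun p : V * W => g p.1).
Proof.
by apply: (Cn_affine (L := @fst V W) (L' := @fst V W)) => // x; exact: cvg_fst.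
Qed.

Lemma Cn_snd (V W : normedModType R) n (g : W -> R) :
  Cn n g -> Cn n (fun p : V * W => g p.2).
Proof.
by apply: (Cn_affine (L := @snd V W) (L' := @snd V W)) => // x; exact: cvg_snd.
Qed.

(** Coefficient by coefficient, from [y^i <= i! exp y] for [y >= 0]. *)
Lemma horner_le_expR (p : {poly R}) :
  exists2 C, 0 <= C & forall y, 0 <= y -> `|p.[y]| <= C * expR y.
Proof.
exists (\sum_(i < size p) `|p`_i| * i`!%:R).
  by apply: sumr_ge0 => i _; rewrite mulr_ge0.
move=> y y0; rewrite horner_coef mulr_suml; apply: le_trans (ler_norm_sum _ _ _) _.
apply: ler_sum => i _; rewrite normrM -mulrA ler_wpM2l// normrX ger0_norm//.
case: (i : nat) => [|k].
  by rewrite expr0 fact0 mul1r; apply: le_trans (expR_ge1Dx y); rewrite lerDl.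
rewrite mulrC -ler_pdivrMr ?ltr0n ?fact_gt0//.
by apply: le_trans (expR_ge1Dxn k y0); rewrite lerDr.
Qed.

(* The family P(1/x) exp(-1/x) on x > 0, extended by 0, is stable under
   differentiation, which makes its members smooth. *)
Definition flat (p : {poly R}) (x : R) : R :=
  if 0 < x then p.[x^-1] * expR (- x^-1) else 0.

(** The exponential bound for [p * 'X^2], read at [1/x]. A quadratic bound at 0 makes the difference
    quotient there tend to 0. *)
Lemma flat_bound (p : {poly R}) :
  exists2 C, 0 <= C & forall x, `|flat p x| <= C * x ^+ 2.
Proof.
have [C C0 pC] := horner_le_expR (p * 'X^2); exists C => // x; rewrite /flat.
case: ifPn => x0; last by rewrite normr0 mulr_ge0// sqr_ge0.
have y0 : 0 <= x^-1 by rewrite invr_ge0 ltW.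
have := pC _ y0; rewrite hornerM hornerXn normrM normrX (ger0_norm y0).
rewrite normrM (ger0_norm (expR_ge0 _)) expRN ler_pdivrMr ?expR_gt0//.
move=> h; rewrite -(@ler_pM2r _ (x^-1 ^+ 2)) ?exprn_gt0 ?invr_gt0//.
apply: le_trans h _; rewrite mulrAC -[_ * _ * x^-1 ^+ 2]mulrA -exprMn divff ?gt_eqF//.
by rewrite expr1n mulr1.
Qed.

(** With [y = 1/x] one has [dy/dx = - y^2], so the derivative of [p(y) exp(- y)] in [x] is
    [y^2 (p(y) - p'(y)) exp(- y)]. *)
Definition flat_deriv (p : {poly R}) : {poly R} := 'X^2 * (p - p^`()).

Lemma is_derive_flat (p : {poly R}) (x : R) :
  is_derive x 1 (flat p) (flat (flat_deriv p) x).
Proof.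
have [x0|x0|->] := ltgtP x 0.
- apply: (near_eq_is_derive (f := cst 0)) => //.
    by near=> y; rewrite /flat ifF//; apply/negbTE; rewrite -leNgt ltW//; near: y; exact: lt_nbhsl.
  by rewrite /flat ifF ?(lt_gtF x0)//; exact: is_derive_cst.
- apply: (@near_eq_is_derive _ R R (fun y : R => p.[y^-1] * expR (- y^-1))) => //.
    by near=> y; rewrite /flat ifT//; near: y; exact: lt_nbhsr.
  have dV : is_derive x 1 (fun y : R => y^-1) (- x ^- 2).
    apply: is_derive_eq; first by apply: is_deriveV; rewrite gt_eqF.
    by rewrite /GRing.scale/= mulr1.
  have dp : is_derive x 1 (fun y : R => p.[y^-1]) (p^`().[x^-1] * - x ^- 2).
    exact: (is_derive1_comp (f := horner p)).
  have dE : is_derive x 1 (fun y : R => expR (- y^-1)) (expR (- x^-1) * - - x ^- 2).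
    exact: (is_derive1_comp (f := expR)).
  apply: is_derive_eq.
  rewrite /flat x0 /flat_deriv hornerM hornerXn hornerD hornerN /GRing.scale/= exprVn.
  by ring.
(* At 0 the difference quotient is at most [C |h|] in absolute value; the threshold below is
   [e / (C + 1)] because [C] may be 0. *)
- have [C C0 fC] := flat_bound p.
  have f0 : flat p 0 = 0 by rewrite /flat ltxx.
  rewrite [flat _ 0]/flat ltxx.
  have cv : (h^-1 *: ((flat p \o shift 0) (h *: 1) - flat p 0)) @[h --> 0^'] --> (0 : R).
    apply/cvgrPdist_le => e e0; near=> h.
    rewrite /= f0 subr0 sub0r normrN addr0 /GRing.scale/= mulr1 normrM normfV.
    have h0 : 0 < `|h| by rewrite normr_gt0; near: h; exact: nbhs_dnbhs_neq.
    rewrite ler_pdivrMl// (le_trans (fC _))// -real_normK ?num_real// expr2 mulrCA ler_pM2l//.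
    have : `|h| <= e / (C + 1).
      near: h; apply: dnbhs0_le; rewrite divr_gt0// ltr_wpDl//.
    rewrite ler_pdivlMr ?ltr_wpDl//; nra.
  split; first by apply/cvg_ex; exists 0.
  exact/cvg_lim.
Unshelve. all: by end_near. Qed.

Lemma smooth_flat (p : {poly R}) : smooth (flat p).
Proof.
move=> n; elim: n p => [|n IHn] p; split=> //; try by move=> x;
  apply/differentiable_continuous/derivable1_diffP; have [] := is_derive_flat p x.
move=> v; have d x : derivable (flat p) x v.
  by apply/diff_derivable/derivable1_diffP; have [] := is_derive_flat p x.
split=> //.
(* On the line, the derivative along [v] is [v] times the derivative along 1, so one polynomial
   serves all directions. *)
rewrite (_ : (fun x => _) = (fun x => cst v x * flat (flat_deriv p) x)).
  by apply: CnM; [exact: Cn_cst|exact: IHn].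
apply/funext => x; have [df <-] := is_derive_flat p x.
have dd : differentiable (flat p) x by exact/derivable1_diffP.
by rewrite !deriveE// -[v in LHS]mulr1 -[v * 1]/(v *: 1) linearZ.
Qed.

End SmoothFunctions.

(** * The cut-off in time *)

Section CutOff.
Context {R : realType}.
Local Notation bump := (@flat R 1).

Lemma flat1_ge0 x : 0 <= bump x.
Proof. by rewrite /flat; case: ifPn => // _; rewrite hornerE mul1r expR_ge0. Qed.

Lemma flat1_le1 x : bump x <= 1.
Proof.
rewrite /flat; case: ifPn => // x0.
by rewrite hornerE mul1r expR_le1 oppr_le0 invr_ge0 ltW.
Qed.

Lemma flat1_ge x : 0 < x -> 1 - x^-1 <= bump x.
Proof. by move=> x0; rewrite /flat x0 hornerE mul1r expR_ge1Dx. Qed.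

(** For [p = 1] the derivative is [y^2 exp(- y)] at [y = 1/x], and [exp y >= 1 + y^2 / 2]. *)
Lemma flat1_deriv_bound x : `|flat (flat_deriv (1 : {poly R})) x| <= 2.
Proof.
rewrite /flat /flat_deriv; case: ifPn => [x0|_]; last by rewrite normr0.
rewrite derivC subr0 mulr1 hornerXn ger0_norm; last first.
  by rewrite mulr_ge0 ?expR_ge0// exprn_ge0// invr_ge0 ltW.
rewrite expRN ler_pdivrMr ?expR_gt0//.
have y0 : 0 <= x^-1 by rewrite invr_ge0 ltW.
have := expR_ge1Dxn 1 y0; rewrite (_ : 2`!%:R = 2 :> R)//.
by move=> ?; lra.
Qed.

(* theta(t) = exp(- k / (t - 1)) exp(- k / (T - t)) has slope O(1/k). *)
Lemma cut_off (k T : R) : 1 <= k ->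
  exists th : R -> R, [/\ smooth th, forall t, 0 <= th t <= 1,
    forall t, ~~ (1 <= t <= T) -> derive1 th t = 0 /\ th t = 0,
    forall t, `|derive1 th t| <= 4 / k &
    forall t, 1 + k ^+ 2 <= t <= T - k ^+ 2 -> 1 - 2 / k <= th t].
Proof.
move=> k1; have k0 : 0 < k by rewrite (lt_le_trans ltr01).
have ki : 0 <= k^-1 by rewrite invr_ge0 ltW.
(* The rise starts at time 1 rather than 0, since a test field must vanish near the initial time.
   The arguments are written in the affine form [a * t + b] to which the smoothness lemma
   applies. *)
pose up t := bump (k^-1 * t - k^-1); pose dn t := bump (- k^-1 * t + T / k).
have upE t : k^-1 * t - k^-1 = (t - 1) / k by field; rewrite gt_eqF.
have dnE t : - k^-1 * t + T / k = (T - t) / k by field; rewrite gt_eqF.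
pose up' t := flat (flat_deriv 1) (k^-1 * t - k^-1) * k^-1.
pose dn' t := flat (flat_deriv 1) (- k^-1 * t + T / k) * - k^-1.
have D (a b t : R) : is_derive t 1 (fun t => bump (a * t + b))
    (flat (flat_deriv 1) (a * t + b) * a).
  apply: is_derive1_comp; first exact: is_derive_flat.
  by apply: is_derive_eq; rewrite /GRing.scale/= ?mulr1 ?addr0 ?scaler0 ?add0r.
have derE t : derive1 (fun t => up t * dn t) t = up t * dn' t + dn t * up' t.
  have dU := D k^-1 (- k^-1) t; have dD := D (- k^-1) (T / k) t.
  rewrite derive1E (_ : (fun t => up t * dn t) = up * dn)//.
  rewrite deriveM; [|by case: dU|by case: dD].
  by have [_ ->] := dU; have [_ ->] := dD.
exists (fun t => up t * dn t); split.
- by move=> n; apply: CnM; apply: Cn_shift_scale; exact: smooth_flat.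
- move=> t; rewrite mulr_ge0 ?flat1_ge0//=.
  by rewrite mulr_ile1 ?flat1_ge0 ?flat1_le1.
- move=> t; rewrite negb_and -!ltNge derE => t1T.
  suff [[-> ->]|[-> ->]] : up t = 0 /\ up' t = 0 \/ dn t = 0 /\ dn' t = 0.
  + by rewrite !mul0r mulr0 addr0.
  + by rewrite !mulr0 mul0r addr0.
  have Z p s c : s < 0 -> flat p (s / k) * c = 0.
    by move=> s0; rewrite /flat ltNge ltW ?mul0r// pmulr_llt0 ?invr_gt0.
  rewrite /up /up' /dn /dn' !upE !dnE; move: t1T => /orP[t1|tT].
    by left; rewrite Z ?subr_lt0// -[bump _]mulr1 Z ?subr_lt0.
  by right; rewrite Z ?subr_lt0// -[bump _]mulr1 Z ?subr_lt0.
- move=> t; rewrite derE /up' /dn'.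
  have B x := flat1_deriv_bound x.
  apply: le_trans (ler_normD _ _) _.
  have E x c : 0 <= x <= 1 -> `|c| <= 2 -> `|x * (c * k^-1)| <= 2 / k.
    move=> /andP[x0 x1] c2; rewrite !normrM (ger0_norm x0) (ger0_norm ki).
    rewrite mulrA ler_pM2r ?invr_gt0//; nra.
  rewrite mulrN mulrN normrN (_ : 4 / k = 2 / k + 2 / k); last by field; rewrite gt_eqF.
  by rewrite lerD// E ?flat1_ge0 ?flat1_le1.
- move=> t /andP[t1 tT].
  (* At distance [s >= k^2] from an end, [exp(- k/s) >= 1 - k/s >= 1 - 1/k]; the product of both
     factors is then at least [(1 - 1/k)^2 >= 1 - 2/k]. *)
  have F s : k ^+ 2 <= s -> 1 - k^-1 <= bump (s / k).
    move=> ks; have s0 : 0 < s by rewrite (lt_le_trans _ ks)// exprn_gt0.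
    apply: le_trans (flat1_ge _); rewrite ?divr_gt0//.
    by rewrite lerD2l lerN2 invf_div ler_pdivrMr// ler_pdivlMl// -expr2.
  have U : 1 - k^-1 <= up t by rewrite /up upE F// lerBrDl.
  have V : 1 - k^-1 <= dn t by rewrite /dn dnE F// lerBrDr -lerBrDl.
  have kj : 0 <= 1 - k^-1 by rewrite subr_ge0 invf_le1.
  have : (1 - k^-1) * (1 - k^-1) <= up t * dn t by exact: ler_pM.
  have : 0 <= k^-1 * k^-1 by rewrite mulr_ge0// invr_ge0 ltW.
  by lra.
Qed.

End CutOff.

(** * Smooth periodic functions as elements of [L^2] *)

Section SmoothPeriodicL2.
Context {R : realType}.

(** Triples carry the product sigma-algebra, so an open set is exhibited as the countable union of
    the cubes with rational centre and radius that it contains. *)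
Lemma open_measurable3 (O : set (R * R * R)) : open O -> measurable (O : set (space R)).
Proof.
move=> oO; pose C (a b c r : rat) : set (space R) :=
  (ball (ratr a : R) (ratr r) `*` ball (ratr b : R) (ratr r)) `*`
   ball (ratr c : R) (ratr r).
rewrite (_ : O = \bigcup_a \bigcup_b \bigcup_c \bigcup_r
    if `[< C a b c r `<=` O >] then C a b c r else set0) => [|].
  do 4 (apply: bigcupT_measurable_rat => ?).
  case: ifPn => // _; apply: measurableX; [apply: measurableX|];
    by apply: open_measurable; exact: ball_open.
apply/seteqP; split=> [[[x y] z] Ox|p]; last first.
  by move=> [a _ [b _ [c _ [r _]]]]; case: ifPn => // /asboolP CO /CO.
have /nbhs_ballP[e /= e0 eO] := open_nbhs_nbhs (conj oO Ox).
(* With [r < e/2], a cube of radius [r] whose centre is within [r] of the point lies in the ball of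
   radius [e] about it. *)
have [r] := rat_in_itvoo (divr_gt0 e0 (ltr0n _ 2)).
rewrite in_itv/= => /andP[r0 re].
have near_rat (t : R) : exists a : rat, `|ratr a - t| < ratr r.
  have : t - ratr r < t + ratr r by rewrite ltrD2l; lra.
  move=> /rat_in_itvoo[a]; rewrite in_itv/= => /andP[? ?]; exists a.
  by rewrite ltr_norml; apply/andP; split; lra.
have [a ha] := near_rat x; have [b hb] := near_rat y; have [c hc] := near_rat z.
exists a => //; exists b => //; exists c => //; exists r => //.
rewrite ifT; first by [].
apply/asboolP => -[[x' y'] z'] [[/= hx hy] hz]; apply: eO.
have tri (s t w : R) : `|s - t| < ratr r -> ball s (ratr r) w -> ball t e w.
  rewrite /ball/= => st sw; rewrite (_ : t - w = (s - w) - (s - t)); last by ring.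
  by apply: le_lt_trans (ler_normB _ _) _; lra.
by split; [split|]; apply: tri; eassumption.
Qed.

Lemma continuous_measurable3 (g : R * R * R -> R) : continuous g ->
  measurable_fun (setT : set (space R)) g.
Proof.
move=> /continuousP cg; apply: (measurability _ (RGenOpens.measurableE R)).
move=> _ [_ [a [b ->] <-]]; rewrite setTI; apply: open_measurable3.
exact/cg/interval_open.
Qed.

Lemma continuous_box_bounded (l : R) (g : R * R * R -> R) : continuous g ->
  exists2 M, 0 <= M & forall x, box l x -> `|g x| <= M.
Proof.
move=> cg; pose K : set (R * R * R) := (`[0, l] `*` `[0, l]) `*` `[0, l].
have cK : compact K.
  by apply: compact_setX; [apply: compact_setX|]; exact: segment_compact.
have /ex_strict_bound_gt0[M M0 /= gM] : bounded_set (g @` K).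
  apply: compact_bounded; apply: continuous_compact => //.
  exact: continuous_subspaceT.
exists M; first exact: ltW.
move=> x [[x1 x2] x3]; apply/ltW/gM; exists x => //.
by split; [split|]; exact: subset_itv_oo_cc.
Qed.

Lemma continuous_L2per (l : R) (g : R * R * R -> R) : continuous g ->
  Defs.periodic l g -> L2per l g.
Proof.
move=> cg pg; have mg := continuous_measurable3 cg; split=> //.
have [M M0 gM] := continuous_box_bounded l cg.
apply: (@le_integrable_EFin _ _ _ _ _ (measurable_box l) _ (cst (M ^+ 2))).
- by apply: measurable_funX; exact: measurable_funS mg.
- move=> x bx; rewrite ger0_norm ?sqr_ge0// -real_normK ?num_real//.
  by rewrite lerXn2r ?nnegrE ?gM.
- exact: integrable_EFin_cst (leb3_box_lty l).
Qed.

Lemma smooth_L2per (l : R) (g : R * R * R -> R) : smooth g ->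
  Defs.periodic l g -> L2per l g.
Proof. by move=> sg; apply: continuous_L2per; exact: Cn_continuous (sg 0%N). Qed.

Lemma smooth_partial j (g : R * R * R -> R) : smooth g -> smooth (partial j g).
Proof. by move=> sg n; have [_ /(_ (axis R j))[]] := sg n.+1. Qed.

Lemma smooth_derivable (V : normedModType R) (g : V -> R) x v : smooth g -> derivable g x v.
Proof. by move=> /(_ 1%N)[_ /(_ v)[]]. Qed.

Lemma periodic_partial l j (g : R * R * R -> R) : Defs.periodic l g ->
  Defs.periodic l (partial j g).
Proof.
move=> pg k x; rewrite /partial /derive; congr (lim _).
by under eq_fun do rewrite /= addrA !pg.
Qed.

Lemma partialZ j c (g : R * R * R -> R) : smooth g ->
  partial j (fun x => c * g x) = (fun x => c * partial j g x).
Proof.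
move=> sg; apply/funext => x; rewrite /partial.
by rewrite (@deriveZ _ _ _ g c)//; exact: smooth_derivable.
Qed.

End SmoothPeriodicL2.

(** * [L^2] bounds for the filter, the residual and its square root *)

Section Operators.
Context {R : realType} (l : R).
Implicit Types (A : (R * R * R -> R) -> R * R * R -> R) (g h : R * R * R -> R).

(** The filter is fixed only up to almost everywhere equality. A bound on squared norms does not see
    this ambiguity and passes to the sums and compositions that build the residual operator. *)
Definition L2bounded A := exists2 C : R, 0 <= C & forall g, L2per l g ->
  L2per l (A g) /\ box_ip l (A g) (A g) <= C * box_ip l g g.

Lemma box_sqnormD_le g h : L2per l g -> L2per l h ->
  box_ip l (fun x => g x + h x) (fun x => g x + h x)
  <= 2 * (box_ip l g g + box_ip l h h).
Proof.
move=> Lg Lh; have LD := L2perD Lg Lh.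
rewrite box_ipDl// !box_ipDr// (box_ipC l h g).
by have := box_ip_young ltr01 Lg Lh; rewrite invr1 !mul1r; lra.
Qed.

Lemma L2boundedD A1 A2 : L2bounded A1 -> L2bounded A2 ->
  L2bounded (fun g x => A1 g x + A2 g x).
Proof.
move=> [C1 C10 H1] [C2 C20 H2]; exists (2 * (C1 + C2)).
  by rewrite mulr_ge0// addr_ge0.
move=> g Lg; have [L1 B1] := H1 _ Lg; have [L2 B2] := H2 _ Lg.
split; first exact: L2perD.
by apply: le_trans (box_sqnormD_le L1 L2) _; rewrite -mulrA ler_pM2l// mulrDl lerD.
Qed.

Lemma L2bounded_comp A1 A2 : L2bounded A1 -> L2bounded A2 ->
  L2bounded (A1 \o A2).
Proof.
move=> [C1 C10 H1] [C2 C20 H2]; exists (C1 * C2); first exact: mulr_ge0.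
move=> g Lg; have [L2 B2] := H2 _ Lg; have [L1 B1] := H1 _ L2.
by split=> //; apply: le_trans B1 _; rewrite -mulrA ler_wpM2l.
Qed.

Lemma L2bounded_id : L2bounded id.
Proof. by exists 1 => // g Lg; rewrite mul1r. Qed.

Lemma L2boundedN A : L2bounded A -> L2bounded (fun g x => - A g x).
Proof.
move=> [C C0 H]; exists C => // g Lg; have [L B] := H _ Lg.
have LZ := L2perZ (-1) L.
rewrite (_ : (fun x => - A g x) = (fun x => -1 * A g x)); last first.
  by apply/funext => x; rewrite mulN1r.
by split=> //; rewrite box_ipZl// box_ipZr// !mulN1r opprK.
Qed.

Lemma L2boundedB A1 A2 : L2bounded A1 -> L2bounded A2 ->
  L2bounded (fun g => A1 g \- A2 g).
Proof. by move=> B1 B2; exact: L2boundedD B1 (L2boundedN B2). Qed.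

Lemma L2bounded_sum (I : Type) (s : seq I) (F : I -> (R * R * R -> R) -> R * R * R -> R) :
  (forall i, L2bounded (F i)) -> L2bounded (fun g x => \sum_(i <- s) F i g x).
Proof.
move=> BF; elim: s => [|i s IHs].
  rewrite (_ : (fun _ => _) = (fun g x => g x + - g x)); last first.
    by apply/funext => g; apply/funext => x; rewrite big_nil subrr.
  exact: L2boundedB L2bounded_id L2bounded_id.
rewrite (_ : (fun _ => _) = (fun g x => F i g x + \sum_(i <- s) F i g x)).
  exact: L2boundedD.
by apply/funext => g; apply/funext => x; rewrite big_cons.
Qed.

Context (delta : R) (G : (R * R * R -> R) -> R * R * R -> R).

(** Testing the Helmholtz equation with its own solution gives
    [delta^2 ||D||^2 + ||G g||^2 = (g, G g)], and Young's inequality yields the constant 1. *)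
Lemma is_filter_L2bounded : is_filter l delta G -> L2bounded G.
Proof.
move=> GF; exists 1 => // g Lg; have [D HD eqG] := GF _ Lg.
have [LG _ _] := HD; split=> //.
have := eqG _ _ HD; have := box_ip_young ltr01 Lg LG.
have : 0 <= delta ^+ 2 * vec_ip l D D.
  by rewrite mulr_ge0 ?sqr_ge0//; exact: vec_sqnorm_ge0.
by rewrite invr1 !mul1r; lra.
Qed.

Lemma residual_L2bounded N : is_filter l delta G -> L2bounded (residual G N).
Proof.
move=> /is_filter_L2bounded BG; apply: L2boundedB; first exact: L2bounded_id.
apply: (L2bounded_comp (A1 := deconv G N)) => //; apply: L2bounded_sum => n.
elim: (n : nat) => [|k IHk]; first exact: L2bounded_id.
exact: (L2bounded_comp (A1 := fun psi => psi \- G psi))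
  (L2boundedB L2bounded_id BG) IHk.
Qed.

Context (A Q : (R * R * R -> R) -> R * R * R -> R).
Hypotheses (bA : L2bounded A) (sQ : is_sqrt_op l A Q).

Lemma sqrt_op_ip g h : L2per l g -> L2per l h ->
  box_ip l (A g) h = box_ip l (Q g) (Q h).
Proof.
move=> Lg Lh; have [LQ symQ _ QQ] := sQ; have [_ _ /(_ _ Lg)[LA _]] := bA.
rewrite symQ//; last exact: LQ.
rewrite -(box_ip_eq_box _ _ _ (QQ _ Lg))//; try exact/LQ/LQ.
by rewrite symQ//; [rewrite symQ//; exact: LQ|exact: LQ].
Qed.

(** Since [||Q g||^2 = (A g, g)], the bound on [A] passes to [Q] by Young's inequality. It is used
    to dominate [||Q u(t)||^2] by a multiple of [||u(t)||^2] in time. *)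
Lemma sqrt_op_bounded : exists2 C, 0 <= C &
  forall g, L2per l g -> box_ip l (Q g) (Q g) <= C * box_ip l g g.
Proof.
have [C C0 HA] := bA; exists (2^-1 * (C + 1)); first by rewrite mulr_ge0// addr_ge0.
move=> g Lg; have [LA BA] := HA _ Lg; rewrite -sqrt_op_ip//.
by have := box_ip_young ltr01 LA Lg; rewrite invr1 !mul1r; nra.
Qed.

End Operators.

(** * Measurability in time *)

Section TimeMeasurability.
Context {R : realType} (l : R).

Local Notation halfline := (`[0%R, +oo[%classic : set (measurableTypeR R)).

(** Freezing [g] at its initial value for negative times moves the question from the half-line to
    the whole line, where continuity and semicontinuity give measurability. *)
Lemma within_continuous_max0 (g : R -> R) :
  {within `[0, +oo[, continuous g} -> continuous (fun t : R => g (Num.max t 0)).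
Proof.
move=> /subspace_continuousP cg t.
have D (s : R) : `[0, +oo[%classic (Num.max s 0) by rewrite /= in_itv/= andbT le_max lexx orbT.
have cm : Num.max s 0 @[s --> t] --> Num.max t 0.
  by apply: (continuous_max (g := cst 0)); [exact: cvg_id|exact: cvg_cst].
apply: cvg_trans (cg _ (D t)) => P /= cP.
have : \forall s \near Num.max t 0, `[0, +oo[%classic s -> P (g s) by exact: cP.
move=> /cm H; have {}H : \forall s \near t, `[0, +oo[%classic (Num.max s 0) ->
    P (g (Num.max s 0)) by exact: H.
by apply: filterS H => s; exact.
Qed.

Lemma measurable_fun_max0 (g : R -> R) :
  measurable_fun (setT : set (measurableTypeR R)) (fun t : R => g (Num.max t 0)) ->
  measurable_fun halfline g.
Proof.
move=> mg; apply: (eq_measurable_fun (fun t : R => g (Num.max t 0))).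
  by move=> t; rewrite inE /= in_itv/= andbT => t0; rewrite /Num.max ltNge t0.
exact: measurable_funTS.
Qed.

Lemma within_continuous_measurable (g : R -> R) :
  {within `[0, +oo[, continuous g} -> measurable_fun halfline g.
Proof.
move=> cg; apply: measurable_fun_max0; apply: continuous_measurable_fun.
exact: within_continuous_max0.
Qed.

(* ||v||^2 is the supremum over w of 2 (v, w) - ||w||^2, hence lower
   semicontinuous in time for a weakly continuous v. *)
Lemma vec_sqnorm_measurable (v : R -> 'I_3 -> R * R * R -> R) :
  (forall t i, 0 <= t -> L2per l (v t i)) ->
  (forall w, (forall i, L2per l (w i)) ->
    {within `[0, +oo[, continuous (fun t => vec_ip l (v t) w)}) ->
  measurable_fun halfline (fun t => vec_sqnorm l (v t)).
Proof.
move=> Lv cv; apply: measurable_fun_max0; apply/measurable_EFinP.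
apply: lower_semicontinuous_measurable => t a; rewrite lte_fin => at0.
have L s i : L2per l (v (Num.max s 0) i) by apply: Lv; rewrite le_max lexx orbT.
pose w := v (Num.max t 0).
(* The minorant for [w = v(t)]: it equals [||v(t)||^2] at time [t], and at any time falls short of
   the squared norm by [||v - w||^2]. *)
pose h s := 2 * vec_ip l (v (Num.max s 0)) w - vec_sqnorm l w.
have ch : continuous h.
  move=> s; apply: cvgB; last exact: cvg_cst.
  apply: cvgM; first exact: cvg_cst.
  exact: (within_continuous_max0 (cv w (L t))).
exists [set s | a < h s].
  apply: (cvgr_gt _ (ch t)); rewrite /h /w -/(vec_sqnorm l _); lra.
move=> s /= ah; rewrite lte_fin (lt_le_trans ah)// /h.
by have := vec_ip_young ltr01 (L s) (L t); rewrite invr1 !mul1r -/w; lra.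
Qed.

(** Tonelli's theorem is applied separately to the positive and negative parts of [F], extended by 0
    outside the product of the half-line and the box. *)
Lemma box_integral_measurable (F : R * (R * R * R) -> R) :
  measurable_fun ([set p | 0 <= p.1] : set (measurableTypeR R * space R)) F ->
  measurable_fun halfline (fun t => \int[leb3 R]_(x in box l) (F (t, x))%:E)%E.
Proof.
move=> mF; pose D : set (measurableTypeR R * space R) := `[0, +oo[ `*` box l.
have mD : measurable D by apply: measurableX => //; exact: measurable_itv.
have mFD : measurable_fun setT (F \_ D).
  apply/(measurable_restrictT _ mD).
  apply: measurable_funS mF; last first.
    by move=> [t x] [/= + _]; rewrite in_itv/= andbT.
  rewrite (_ : [set p | _] = halfline `*` setT).
    by apply: measurableX => //; exact: measurable_itv.
  by apply/seteqP; split=> [[t x]|[t x] []] /=; rewrite in_itv/= andbT.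
have mE : measurable_fun setT (EFin \o (F \_ D)) by exact/measurable_EFinP.
have mI : measurable_fun (setT : set (measurableTypeR R))
    (fun t => \int[leb3 R]_x (EFin \o (F \_ D)) (t, x))%E.
  under eq_fun do rewrite integralE.
  have mF2 (H : R * (R * R * R) -> \bar R) :
      measurable_fun (setT : set (measurableTypeR R * space R)) H ->
      (forall p, 0 <= H p)%E ->
      measurable_fun (setT : set (measurableTypeR R))
        (fun t => \int[leb3 R]_x H (t, x))%E.
    move=> mH H0; have := @measurable_fun_fubini_tonelli_F _ _
      (measurableTypeR R) (space R) R
      (@leb3_function R)
      H mH H0.
    exact.
  have mp := mF2 _ (measurable_funepos mE) (funepos_ge0 _).
  have mn := mF2 _ (measurable_funeneg mE) (funeneg_ge0 _).
  apply: eq_measurable_fun (emeasurable_funB mp mn) => t _ /=.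
  by congr (_ - _)%E; apply: eq_integral => x _; rewrite ?funeposE ?funenegE.
apply: (eq_measurable_fun
    (fun t => \int[leb3 R]_x (EFin \o (F \_ D)) (t, x))%E).
  move=> t; rewrite inE /= in_itv/= andbT => t0.
  rewrite [RHS]integral_mkcond; apply: eq_integral => x _ /=.
  rewrite /patch; have [bx|bx] := boolP (x \in box l).
    by rewrite ifT//; apply/mem_set; split; [rewrite /= in_itv/= t0|exact/set_mem].
  by rewrite ifF//; apply/negbTE; apply: contra bx => /set_mem[_ /mem_set].
exact: measurable_funTS.
Qed.

Lemma box_Rintegral_measurable (F : R * (R * R * R) -> R) :
  measurable_fun ([set p | 0 <= p.1] : set (measurableTypeR R * space R)) F ->
  measurable_fun halfline (fun t => \int[leb3 R]_(x in box l) F (t, x)).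
Proof.
by move=> /box_integral_measurable mI; apply: measurableT_comp mI.
Qed.

End TimeMeasurability.

(** * Pointwise inequalities for the convection term *)

(** Expansion of [\sum_i (B a_i + s A b_i)^2 >= 0] for [s = 1] and [s = - 1], divided by [A B]; if
    [A] or [B] is 0, every product [a_i b_i] vanishes. *)
Lemma sum_cauchy_schwarz (R : rcfType) (I : finType) (a b : I -> R) :
  `|\sum_i a i * b i| <= Num.sqrt (\sum_i a i ^+ 2) * Num.sqrt (\sum_i b i ^+ 2).
Proof.
set A := Num.sqrt _; set B := Num.sqrt _.
have sqr_sum_ge0 (c : I -> R) : 0 <= \sum_i c i ^+ 2.
  by apply: sumr_ge0 => i _; exact: sqr_ge0.
have A2 : A ^+ 2 = \sum_i a i ^+ 2 by rewrite sqr_sqrtr.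
have B2 : B ^+ 2 = \sum_i b i ^+ 2 by rewrite sqr_sqrtr.
have A0 : 0 <= A by exact: sqrtr_ge0.
have B0 : 0 <= B by exact: sqrtr_ge0.
have zero (c : I -> R) : \sum_i c i ^+ 2 = 0 -> forall i, c i = 0.
  move=> /eqP; rewrite psumr_eq0; last by move=> i _; exact: sqr_ge0.
  by move=> /allP c0 i; apply/eqP; rewrite -sqrf_eq0; apply: c0; exact: mem_index_enum.
have [A_eq0|A_neq0] := eqVneq A 0.
  rewrite big1 ?normr0 ?mulr_ge0// => i _.
  by rewrite (zero a) ?mul0r// -A2 A_eq0 expr0n.
have [B_eq0|B_neq0] := eqVneq B 0.
  rewrite big1 ?normr0 ?mulr_ge0// => i _.
  by rewrite (zero b) ?mulr0// -B2 B_eq0 expr0n.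
have AB_gt0 : 0 < A * B by rewrite lt_neqAle eq_sym mulf_neq0//= mulr_ge0.
have expand s : s ^+ 2 = 1 -> 0 <= 2 * (A * B) * (A * B) + 2 * s * (A * B) * \sum_i a i * b i.
  move=> s2; apply: le_trans (sqr_sum_ge0 (fun i => B * a i + s * A * b i)) _.
  rewrite (eq_bigr (fun i => B ^+ 2 * a i ^+ 2 + A ^+ 2 * b i ^+ 2
      + 2 * s * (A * B) * (a i * b i))); last first.
    move=> i _; rewrite (_ : A ^+ 2 * b i ^+ 2 = s ^+ 2 * A ^+ 2 * b i ^+ 2).
      by ring.
    by rewrite s2 mul1r.
  rewrite !big_split /= -!mulr_sumr -A2 -B2 le_eqVlt; apply/orP; left; apply/eqP.
  by ring.
have bound s : s ^+ 2 = 1 -> 0 <= A * B + s * \sum_i a i * b i.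
  by move=> s2; rewrite -(pmulr_rge0 _ AB_gt0); have := expand s s2; lra.
have := bound 1 (expr1n _ _); have := bound (- 1) (sqrr_sign _ 1%N).
by rewrite ler_norml => ? ?; apply/andP; split; lra.
Qed.

(** Cauchy-Schwarz over pairs of indices: the tensor [a_i a_j] has Frobenius norm [\sum_i a_i^2],
    whence the constant 1. *)
Lemma frobenius_quadratic (R : realType) (A : 'I_3 -> 'I_3 -> R * R * R -> R)
    (a : 'I_3 -> R) x :
  `|\sum_(i < 3) \sum_(j < 3) a i * a j * A i j x|
  <= (\sum_(i < 3) a i ^+ 2) * frobenius A x.
Proof.
rewrite /frobenius !pair_bigA/=.
apply: le_trans (sum_cauchy_schwarz
  (fun p : 'I_3 * 'I_3 => a p.1 * a p.2) (fun p => A p.1 p.2 x)) _.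
rewrite le_eqVlt; apply/orP; left; apply/eqP; congr (_ * _).
rewrite (_ : \sum_i _ = (\sum_(i < 3) a i ^+ 2) ^+ 2).
  by rewrite sqrtr_sqr ger0_norm// sumr_ge0// => i _; exact: sqr_ge0.
rewrite expr2 mulr_suml; under [RHS]eq_bigr do rewrite mulr_sumr.
by rewrite pair_bigA/=; apply: eq_bigr => p _; rewrite exprMn.
Qed.

Lemma L2perM_bounded (R : realType) (l : R) (g h : R * R * R -> R) :
  L2per l g -> continuous h -> Defs.periodic l h ->
  L2per l (fun x => g x * h x).
Proof.
move=> [mg pg ig] ch ph; have mh := continuous_measurable3 ch; split.
- exact: measurable_funM.
- by move=> j x; rewrite pg ph.
- have [M M0 hM] := continuous_box_bounded l ch.
  apply: (@le_integrable_EFin _ _ _ _ _ (measurable_box l) _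
    (fun x => M ^+ 2 * g x ^+ 2)).
  + apply: measurable_funX; apply: measurable_funTS.
    exact: measurable_funM.
  + move=> x bx; rewrite ger0_norm ?sqr_ge0// exprMn mulrC ler_wpM2r ?sqr_ge0//.
    by rewrite -real_normK ?num_real// lerXn2r ?nnegrE// hM.
  + by apply: integrable_EFinZ => //; exact: measurable_box.
Qed.

(** * Energy and forcing estimates for a weak solution *)

Section WeakSolution.
Context {R : realType} {l nu chi : R} (A Q : (R * R * R -> R) -> R * R * R -> R)
  (u0 f : 'I_3 -> R * R * R -> R) (u : R -> 'I_3 -> R * R * R -> R)
  (Du : R -> 'I_3 -> 'I_3 -> R * R * R -> R).
Hypotheses (nu0 : 0 < nu) (chi0 : 0 < chi).
Hypotheses (bA : L2bounded l A) (sQ : is_sqrt_op l A Q).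
Hypothesis (df : smooth_data l f).
Hypothesis (ws : weak_solution l nu chi A u0 f u Du).

Local Notation halfline := (`[0%R, +oo[%classic : set (measurableTypeR R)).
Local Notation segment T := (`[0%R, T]%classic : set (measurableTypeR R)).

Let X t := vec_sqnorm l (u t).
Let W t := nu * ten_sqnorm l (Du t) + chi * vec_sqnorm l (fun i => Q (u t i)).

Let Lu (t : R) i : 0 <= t -> L2per l (u t i).
Proof. by move=> t0; exact: (ws_L2per ws). Qed.

Let Lf i : L2per l (f i).
Proof. by case: df => sf pf _ _; exact: smooth_L2per. Qed.

Let LQ g : L2per l g -> L2per l (Q g).
Proof. by have [H _ _ _] := sQ; exact: H. Qed.

Let LA g : L2per l g -> L2per l (A g).
Proof. by have [C _ H] := bA; move=> /H[]. Qed.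

Lemma segment_halfline T : segment T `<=` halfline.
Proof. by move=> t /=; rewrite !in_itv/= andbT => /andP[]. Qed.

Lemma leb1_segment_lty T : (leb1 R (segment T) < +oo)%E.
Proof.
rewrite /leb1 /= lebesgue_measure_itv /=.
by case: ifPn => // _; rewrite -EFinB ltry.
Qed.

Lemma leb1_segment T : 0 < T -> fine (leb1 R (segment T)) = T.
Proof.
by move=> T0; rewrite /leb1 /= lebesgue_measure_itv /= lte_fin T0 oppr0 adde0.
Qed.

Let mseg T : measurable (segment T).
Proof. exact: measurable_itv. Qed.

Lemma halfline_segment_measurable T (g : R -> R) :
  measurable_fun halfline g -> measurable_fun (segment T) g.
Proof.
by apply: measurable_funS; [exact: measurable_itv|exact: segment_halfline].
Qed.

Lemma sqrt_op_vec_ip t w : 0 <= t -> (forall i, L2per l (w i)) ->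
  vec_ip l (fun i => A (u t i)) w = vec_ip l (fun i => Q (u t i)) (fun i => Q (w i)).
Proof.
by move=> t0 Lw; apply: eq_bigr => i _; rewrite (sqrt_op_ip bA sQ)//; exact: Lu.
Qed.

(** By symmetry [(Q u, w) = (u, Q w)], so weak continuity passes from [u] to [Q u]. *)
Lemma sqrt_op_within_continuous w : (forall i, L2per l (w i)) ->
  {within `[0, +oo[, continuous (fun t => vec_ip l (fun i => Q (u t i)) w)}.
Proof.
move=> Lw; have := ws_weakly_continuous ws (fun i => LQ (Lw i)).
apply: subspace_eq_continuous => t; rewrite inE/= in_itv/= andbT => t0.
apply: eq_bigr => i _; have [_ symQ _ _] := sQ.
by rewrite -symQ//; exact: Lu.
Qed.

Lemma velocity_sqnorm_measurable : measurable_fun halfline X.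
Proof.
apply: vec_sqnorm_measurable => [t i t0|w Lw]; first exact: Lu.
exact: (ws_weakly_continuous ws).
Qed.

Lemma sqrt_op_sqnorm_measurable :
  measurable_fun halfline (fun t => vec_sqnorm l (fun i => Q (u t i))).
Proof.
apply: (vec_sqnorm_measurable (v := fun t i => Q (u t i))) => [t i t0|w Lw].
  exact/LQ/Lu.
exact: sqrt_op_within_continuous.
Qed.

Lemma gradient_sqnorm_measurable : measurable_fun halfline (fun t => ten_sqnorm l (Du t)).
Proof.
apply: measurable_sum => i; apply: measurable_sum => j.
apply: (box_Rintegral_measurable l (F := fun p => Du p.1 i j p.2 * Du p.1 i j p.2)).
by apply: measurable_funM; exact: (ws_grad_measurable ws).
Qed.

(** At almost every time all components are square integrable, so the inner extended integral in
    [ws_L2H1] is the sum of the real squared norms. At the remaining times these may carry default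
    values, hence a comparison almost everywhere. *)
Lemma H1_sqnorm_integrable T : 0 < T ->
  (leb1 R).-integrable (segment T) (EFin \o (fun t => X t + ten_sqnorm l (Du t))).
Proof.
move=> T0.
pose F (p : R * (R * R * R)) :=
  \sum_(i < 3) (u p.1 i p.2 ^+ 2 + \sum_(j < 3) Du p.1 i j p.2 ^+ 2).
have mF : measurable_fun ([set p | 0 <= p.1] : set (measurableTypeR R * space R)) F.
  apply: measurable_sum => i; apply: measurable_funD.
    by apply: measurable_funX; exact: (ws_measurable ws).
  apply: measurable_sum => j; apply: measurable_funX.
  exact: (ws_grad_measurable ws).
have mY := box_integral_measurable l mF.
have m1 : measurable_fun (segment T) (fun t => X t + ten_sqnorm l (Du t)).
  apply: halfline_segment_measurable; apply: measurable_funD.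
    exact: velocity_sqnorm_measurable.
  exact: gradient_sqnorm_measurable.
have ge0 t : 0 <= X t + ten_sqnorm l (Du t).
  rewrite addr_ge0 ?vec_sqnorm_ge0//.
  by apply: sumr_ge0 => i _; exact: vec_sqnorm_ge0.
apply/integrableP; split; first exact/measurable_EFinP.
apply: le_lt_trans (ws_L2H1 ws T0).
apply: ae_ge0_le_integral => //.
- by apply: measurableT_comp => //; exact/measurable_EFinP.
- move=> t _; apply: integral_ge0 => x _; rewrite lee_fin.
  apply: sumr_ge0 => i _; rewrite addr_ge0 ?sqr_ge0//.
  by apply: sumr_ge0 => j _; exact: sqr_ge0.
- by apply: measurable_funS mY; [exact: measurable_itv|exact: segment_halfline].
apply: (@filterS _ _ (ae_filter_ringOfSetsType (leb1 R))) (ws_H1per ws) => t H /= tT.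
have t0 : 0 <= t by move: tT; rewrite in_itv/= => /andP[].
have {}H := H t0; rewrite ger0_norm//.
have Lt i : L2per l (u t i) by have [] := H i.
have LD i j : L2per l (Du t i j) by have [_ + _] := H i; exact.
have sqi g : L2per l g -> (leb3 R).-integrable (box l) (EFin \o (fun x => g x ^+ 2)).
  by case.
have iD i : (leb3 R).-integrable (box l) (EFin \o (fun x => \sum_(j < 3) Du t i j x ^+ 2)).
  by apply: integrable_EFin_sum => // j; exact: sqi.
have iU i : (leb3 R).-integrable (box l)
    (EFin \o (fun x => u t i x ^+ 2 + \sum_(j < 3) Du t i j x ^+ 2)).
  by apply: integrable_EFinD => //; exact: sqi.
rewrite -EFin_Rintegral//;
  [|exact: measurable_box|by apply: (integrable_EFin_sum (measurable_box l))].
rewrite lee_fin (Rintegral_sum (measurable_box l))//.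
rewrite /X /vec_sqnorm /vec_ip /ten_sqnorm -big_split/=.
rewrite le_eqVlt; apply/orP; left; apply/eqP; apply: eq_bigr => i _.
rewrite (RintegralD (measurable_box l))//; last exact: sqi.
rewrite (Rintegral_sum (measurable_box l) _ (fun j => sqi _ (LD i j))).
by congr (_ + _).
Qed.

Let ten_ge0 t : 0 <= ten_sqnorm l (Du t).
Proof. by apply: sumr_ge0 => i _; exact: vec_sqnorm_ge0. Qed.

Lemma velocity_sqnorm_integrable T : 0 < T -> (leb1 R).-integrable (segment T) (EFin \o X).
Proof.
move=> T0; apply: le_integrable_EFin (H1_sqnorm_integrable T0) => //.
  by apply: halfline_segment_measurable; exact: velocity_sqnorm_measurable.
by move=> t _; rewrite ger0_norm ?vec_sqnorm_ge0// lerDl.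
Qed.

Lemma dissipation_integrable T : 0 < T -> (leb1 R).-integrable (segment T) (EFin \o W).
Proof.
move=> T0; have iXT := H1_sqnorm_integrable T0; have iX := velocity_sqnorm_integrable T0.
apply: integrable_EFinD => //.
  apply: integrable_EFinZ => //.
  apply: le_integrable_EFin iXT => //.
    by apply: halfline_segment_measurable; exact: gradient_sqnorm_measurable.
  by move=> t _; rewrite ger0_norm// lerDr vec_sqnorm_ge0.
apply: integrable_EFinZ => //; have [C C0 QC] := sqrt_op_bounded bA sQ.
apply: le_integrable_EFin (integrable_EFinZ (mseg T) C iX) => //.
  by apply: halfline_segment_measurable; exact: sqrt_op_sqnorm_measurable.
move=> t; rewrite /= in_itv/= => /andP[t0 _].
rewrite ger0_norm ?vec_sqnorm_ge0// mulr_sumr; apply: ler_sum => i _.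
by apply: QC; exact: Lu.
Qed.

Lemma segment_cst_integrable T (c : R) :
  (leb1 R).-integrable (segment T) (EFin \o cst c).
Proof. by apply: integrable_EFin_cst => //; exact: leb1_segment_lty. Qed.

Lemma vec_ip_integrable T w : 0 < T -> (forall i, L2per l (w i)) ->
  (leb1 R).-integrable (segment T) (EFin \o (fun t => vec_ip l (u t) w)).
Proof.
move=> T0 Lw; apply: (@le_integrable_EFin _ _ _ _ _ (mseg T) _
  (fun t => 2^-1 * (X t + vec_sqnorm l w))).
- apply: halfline_segment_measurable; apply: within_continuous_measurable.
  exact: (ws_weakly_continuous ws).
- move=> t; rewrite /= in_itv/= => /andP[t0 _]; apply: vec_ip_young_abs => // i.
  exact: Lu.
- apply: integrable_EFinZ => //; apply: integrable_EFinD => //.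
    exact: velocity_sqnorm_integrable.
  exact: segment_cst_integrable.
Qed.

Lemma energy_bound T k : 0 < T -> 0 < k ->
  \int[leb1 R]_(t in `[0, T]) W t <= 2^-1 * vec_sqnorm l u0 +
    2^-1 * (k * T * vec_sqnorm l f + k^-1 * \int[leb1 R]_(t in `[0, T]) X t).
Proof.
move=> T0 k0; have iX := velocity_sqnorm_integrable T0.
have := ws_energy ws (ltW T0).
rewrite (_ : \int[leb1 R]_(s in `[0, T]) (_ + _) = \int[leb1 R]_(t in `[0, T]) W t); last first.
  apply: eq_Rintegral => t; rewrite inE /= in_itv/= => /andP[t0 _].
  by rewrite sqrt_op_vec_ip// => i; exact: Lu.
suff : \int[leb1 R]_(s in `[0, T]) vec_ip l f (u s) <=
    2^-1 * (k * T * vec_sqnorm l f + k^-1 * \int[leb1 R]_(t in `[0, T]) X t).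
  have := vec_sqnorm_ge0 l (u T); lra.
rewrite (_ : 2^-1 * _ = \int[leb1 R]_(t in `[0, T])
    (2^-1 * k * vec_sqnorm l f + 2^-1 * k^-1 * X t)); last first.
  rewrite RintegralD//; last exact: integrable_EFinZ.
  rewrite Rintegral_cst// RintegralZl// leb1_segment//.
    by rewrite mulrDr !mulrA; congr (_ + _); ring.
  exact: segment_cst_integrable.
have le_young t : 0 <= t -> vec_ip l f (u t) <= 2^-1 * k * vec_sqnorm l f + 2^-1 * k^-1 * X t.
  move=> t0; have := vec_ip_young k0 Lf (fun i => Lu i t0); rewrite -/(X t); lra.
apply: le_Rintegral => //.
- rewrite (_ : (fun t => vec_ip l f (u t)) = (fun t => vec_ip l (u t) f)).
    exact: vec_ip_integrable.
  by apply/funext => t; exact: vec_ipC.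
- apply: integrable_EFinD => //; first exact: segment_cst_integrable.
  exact: integrable_EFinZ.
- by move=> t; rewrite /= in_itv/= => /andP[t0 _]; exact: le_young.
Qed.

Let NL t := \sum_(i < 3) \sum_(j < 3)
  \int[leb3 R]_(x in box l) (u t i x * u t j x * partial j (f i) x).

Let sf i : smooth (f i).
Proof. by case: df. Qed.

Let pf i : Defs.periodic l (f i).
Proof. by case: df. Qed.

Let cdf i j : continuous (partial j (f i)).
Proof. exact: Cn_continuous (smooth_partial j (sf i) 0%N). Qed.

Let Ldf i j : L2per l (partial j (f i)).
Proof.
by apply: smooth_L2per; [exact: smooth_partial|exact: periodic_partial].
Qed.

Let Lddf i j : L2per l (partial j (partial j (f i))).
Proof.
by apply: smooth_L2per; [do 2 apply: smooth_partial|do 2 apply: periodic_partial].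
Qed.

Let LLf i : L2per l (laplacian (f i)).
Proof. by apply: L2per_sum => j; exact: Lddf. Qed.

Lemma convection_integrand_integrable t i j : 0 <= t -> (leb3 R).-integrable (box l)
  (EFin \o (fun x => u t i x * u t j x * partial j (f i) x)).
Proof.
move=> t0; under [X in EFin \o X]eq_fun do rewrite -mulrA.
apply: (L2perM_integrable (Lu i t0)).
by apply: (L2perM_bounded (Lu j t0)); [exact: cdf|exact: periodic_partial].
Qed.

(** The pointwise quadratic bound, integrated over the box. The bound [M] is assumed almost
    everywhere because it comes from the essential supremum in [length_scale]. *)
Lemma convection_bound M t : 0 <= t ->
  {ae leb3 R, forall x, box l x -> frobenius (gradient f) x <= M} ->
  `|NL t| <= M * X t.
Proof.
move=> t0 fM; have mb := measurable_box l.
have sqi i : (leb3 R).-integrable (box l) (EFin \o (fun x => u t i x ^+ 2)).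
  by have [] := Lu i t0.
have iS : (leb3 R).-integrable (box l) (EFin \o (fun x =>
    \sum_(i < 3) \sum_(j < 3) u t i x * u t j x * partial j (f i) x)).
  apply: (integrable_EFin_sum mb) => i; apply: (integrable_EFin_sum mb) => j.
  exact: convection_integrand_integrable.
have isq : (leb3 R).-integrable (box l) (EFin \o (fun x => \sum_(i < 3) u t i x ^+ 2)).
  exact: (integrable_EFin_sum mb).
have -> : NL t = \int[leb3 R]_(x in box l)
    \sum_(i < 3) \sum_(j < 3) u t i x * u t j x * partial j (f i) x.
  rewrite (Rintegral_sum mb) => [|i]; last first.
    by apply: (integrable_EFin_sum mb) => j; exact: convection_integrand_integrable.
  apply: eq_bigr => i _; rewrite (Rintegral_sum mb)// => j.
  exact: convection_integrand_integrable.
have -> : M * X t = \int[leb3 R]_(x in box l) (M * \sum_(i < 3) u t i x ^+ 2).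
  by rewrite RintegralZl// (Rintegral_sum mb).
apply: le_trans (le_normr_Rintegral mb iS) _.
apply: (ae_le_Rintegral mb).
- exact: (integrable_norm iS).
- exact: (integrable_EFinZ mb).
apply: (@filterS _ _ (ae_filter_ringOfSetsType (leb3 R))) fM => x fMx bx.
apply: le_trans (frobenius_quadratic (gradient f) (fun i => u t i x) x) _.
rewrite mulrC ler_wpM2r ?fMx// sumr_ge0// => i _; exact: sqr_ge0.
Qed.

Lemma separated_test_field (th : R -> R) (a b : R) : smooth th -> 0 < a ->
  (forall t, ~~ (a <= t <= b) -> th t = 0) ->
  test_field l (fun t i x => th t * f i x).
Proof.
move=> sth a0 th0; split.
- by move=> i n; apply: CnM; [exact: (Cn_fst _ (sth n))|exact: (Cn_snd _ (sf i n))].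
- by move=> t i j x; rewrite pf.
- move=> t x; have [_ _ + _] := df => /(_ x) div0.
  by under eq_bigr do rewrite partialZ//; rewrite -mulr_sumr div0 mulr0.
- by exists a, b; split=> // t i x /th0 ->; rewrite mul0r.
Qed.

Lemma momentum_pairing_separated (th : R -> R) t : smooth th -> 0 <= t ->
  momentum_pairing l nu chi A f (u t) (fun s i x => th s * f i x) t =
  derive1 th t * vec_ip l (u t) f +
  th t * (NL t + nu * vec_ip l (u t) (fun i => laplacian (f i))
    - chi * vec_ip l (fun i => Q (u t i)) (fun i => Q (f i)) + vec_sqnorm l f).
Proof.
move=> sth t0; rewrite /momentum_pairing -sqrt_op_vec_ip//.
have Lut i := Lu i t0; have LAu i : L2per l (A (u t i)) by exact: LA.
have -> : vec_ip l (u t) (fun i x => derive1 (fun s => th s * f i x) t) =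
    derive1 th t * vec_ip l (u t) f.
  rewrite -vec_ipZr//; apply: eq_bigr => i _; congr box_ip; apply/funext => x.
  by rewrite derive1Mr//; exact: smooth_derivable.
have -> : \sum_(i < 3) \sum_(j < 3) \int[leb3 R]_(x in box l)
    (u t i x * u t j x * partial j (fun x => th t * f i x) x) = th t * NL t.
  rewrite mulr_sumr; apply: eq_bigr => i _; rewrite mulr_sumr.
  apply: eq_bigr => j _; rewrite partialZ//.
  rewrite -RintegralZl//; last exact: convection_integrand_integrable.
  by apply: eq_Rintegral => x _; rewrite mulrCA.
have -> : vec_ip l (u t) (fun i => laplacian (fun x => th t * f i x)) =
    th t * vec_ip l (u t) (fun i => laplacian (f i)).
  rewrite -vec_ipZr//; apply: eq_bigr => i _; congr box_ip; apply/funext => x.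
  rewrite /laplacian mulr_sumr; apply: eq_bigr => j _.
  by rewrite partialZ// partialZ//; exact: smooth_partial.
rewrite [in X in _ - X](vec_ipZr (th t) LAu Lf) [in X in _ + X](vec_ipZr (th t) Lf Lf).
by rewrite -/(vec_sqnorm l f); ring.
Qed.

(** Each [partial j (f i)] is itself smooth and periodic, hence admissible in the definition of the
    weak gradient. *)
Lemma viscous_term t : (forall i, H1per l (u t i) (Du t i)) ->
  vec_ip l (u t) (fun i => laplacian (f i)) =
  - \sum_(i < 3) vec_ip l (Du t i) (gradient f i).
Proof.
move=> H; rewrite -sumrN; apply: eq_bigr => i _; have [Lui _ wg] := H i.
rewrite box_ip_sumr => [|//|j]; last exact: Lddf.
rewrite -sumrN; apply: eq_bigr => j _; apply: wg; first exact: smooth_partial.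
exact: periodic_partial.
Qed.

(** The analogue of [W] for the field [f]: the factor paired with [W t] by Young's inequality. *)
Let S := nu * ten_sqnorm l (gradient f) + chi * vec_sqnorm l (fun i => Q (f i)).

(** The viscous and the relaxation terms get the same weight, so that the parts containing [u] add
    up to exactly [W t]. *)
Lemma dissipative_young m t : 0 < m -> 0 <= t ->
  (forall i, H1per l (u t i) (Du t i)) ->
  - (nu * vec_ip l (u t) (fun i => laplacian (f i))
     - chi * vec_ip l (fun i => Q (u t i)) (fun i => Q (f i)))
  <= 2^-1 * (m * S + m^-1 * W t).
Proof.
move=> m0 t0 H; rewrite viscous_term//.
have yD : \sum_(i < 3) vec_ip l (Du t i) (gradient f i)
    <= 2^-1 * (m^-1 * ten_sqnorm l (Du t) + m * ten_sqnorm l (gradient f)).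
  rewrite /ten_sqnorm !mulr_sumr -big_split/= mulr_sumr; apply: ler_sum => i _.
  have mi : 0 < m^-1 by rewrite invr_gt0.
  have [_ LD _] := H i; have := vec_ip_young mi LD (Ldf i).
  by rewrite invrK.
have yQ : vec_ip l (fun i => Q (u t i)) (fun i => Q (f i))
    <= 2^-1 * (m^-1 * vec_sqnorm l (fun i => Q (u t i))
               + m * vec_sqnorm l (fun i => Q (f i))).
  have mi : 0 < m^-1 by rewrite invr_gt0.
  have := vec_ip_young mi (fun i => LQ (Lu i t0)) (fun i => LQ (Lf i)).
  by rewrite invrK.
rewrite mulrN opprB opprK addrC.
apply: le_trans (lerD (ler_wpM2l (ltW nu0) yD) (ler_wpM2l (ltW chi0) yQ)) _.
by rewrite /S /W le_eqVlt; apply/orP; left; apply/eqP; ring.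
Qed.

Lemma bounded_mul_integrable T (c : R) (g h : R -> R) : 0 <= c ->
  (forall t, `|g t| <= c) -> continuous g ->
  (leb1 R).-integrable (segment T) (EFin \o h) ->
  (leb1 R).-integrable (segment T) (EFin \o (fun t => g t * h t)).
Proof.
move=> c0 gc cg ih; apply: (@le_integrable_EFin _ _ _ _ _ (mseg T) _
  (fun t => c * `|h t|)).
- apply: measurable_funM; last by apply/measurable_EFinP; exact: measurable_int ih.
  by apply: measurable_funTS; exact: continuous_measurable_fun.
- by move=> t _; rewrite normrM ler_wpM2r.
- by apply: integrable_EFinZ => //; exact: (integrable_norm ih).
Qed.

Lemma convection_integrable T M : 0 < T ->
  {ae leb3 R, forall x, box l x -> frobenius (gradient f) x <= M} ->
  (leb1 R).-integrable (segment T) (EFin \o NL).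
Proof.
move=> T0 fM; apply: (@le_integrable_EFin _ _ _ _ _ (mseg T) _ (fun t => M * X t)).
- apply: halfline_segment_measurable; apply: measurable_sum => i.
  apply: measurable_sum => j; apply: (box_Rintegral_measurable l
    (F := fun p => u p.1 i p.2 * u p.1 j p.2 * partial j (f i) p.2)).
  apply: measurable_funM.
    by apply: measurable_funM; exact: (ws_measurable ws).
  apply: measurable_funTS.
  have H : measurable_fun (setT : set (measurableTypeR R * space R))
      (partial j (f i) \o snd).
    apply: measurableT_comp; last exact: measurable_snd.
    exact: continuous_measurable3.
  exact: H.
- move=> t; rewrite /= in_itv/= => /andP[t0 _]; exact: convection_bound.
- by apply: integrable_EFinZ => //; exact: velocity_sqnorm_integrable.
Qed.

(** The terms in [k] are the cost of the cut-off. On the right, [2 / k] is its slope [4 / k] times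
    the 1/2 of Young's inequality; on the left, [1 - 2 / k] is its height on the plateau and
    [T - 1 - 2 k^2] the length of the plateau. *)
Lemma forcing_bound T k m M : 1 <= k -> 0 < m -> 1 + 2 * k ^+ 2 < T ->
  {ae leb3 R, forall x, box l x -> frobenius (gradient f) x <= M} ->
  vec_sqnorm l f * (1 - 2 / k) * (T - 1 - 2 * k ^+ 2) <=
  (2^-1 * m * S + 2 / k * vec_sqnorm l f) * T
  + (M + 2 / k) * \int[leb1 R]_(t in `[0, T]) X t
  + 2^-1 * m^-1 * \int[leb1 R]_(t in `[0, T]) W t.
Proof.
move=> k1 m0 kT fM; have k0 : 0 < k by rewrite (lt_le_trans ltr01).
have T0 : 0 < T by rewrite (lt_trans _ kT)// ltr_wpDr// mulr_ge0// sqr_ge0.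
have [th [sth th01 thout dth thge]] := cut_off T k1.
set F2 := vec_sqnorm l f.
pose p t := vec_ip l (u t) f.
pose V t := nu * vec_ip l (u t) (fun i => laplacian (f i))
  - chi * vec_ip l (fun i => Q (u t i)) (fun i => Q (f i)).
pose H t := derive1 th t * p t + th t * (NL t + V t + F2).
have H_eq0 t : ~~ (1 <= t <= T) -> H t = 0.
  by move=> /thout[e1 e2]; rewrite /H e1 e2 !mul0r addr0.
(* The weak formulation integrates over the open half-line. As [theta] and its derivative vanish
   outside [[1, T]], the integral may be taken over [[0, T]] instead, the endpoint 0 contributing
   the value 0. *)
have int_H : \int[leb1 R]_(t in `[0, T]) H t = 0.
  apply: etrans (ws_momentum ws
    (separated_test_field sth ltr01 (fun t h => (thout t h).2))).
  rewrite [LHS]Rintegral_mkcond [RHS]Rintegral_mkcond.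
  apply: eq_Rintegral => t _; rewrite /patch !mem_setE !in_itv/= andbT.
  have [t_gt0|t_lt0|<-] := ltgtP 0 t.
  - rewrite (momentum_pairing_separated sth (ltW t_gt0)) -/(p t) -(addrA (NL t)) -/(V t) -/(H t).
    by case: ifPn => // tT; rewrite H_eq0// negb_and tT orbT.
  - by [].
  - by rewrite ltW//= H_eq0// ler10.
have iX := velocity_sqnorm_integrable T0; have iW := dissipation_integrable T0.
have icst c : (leb1 R).-integrable (segment T) (EFin \o cst c).
  exact: segment_cst_integrable.
have iV : (leb1 R).-integrable (segment T) (EFin \o V).
  apply: (integrable_EFinB (mseg T)); apply: (integrable_EFinZ (mseg T)).
    exact: vec_ip_integrable.
  (* Written as [(u, Q (Q f))], the relaxation term is a pairing of [u] with a fixed field, and weak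
     continuity applies. *)
  apply: (eq_integrable (mseg T)
      (EFin \o (fun t => vec_ip l (u t) (fun i => Q (Q (f i)))))).
    move=> t; rewrite inE/= in_itv/= => /andP[t0 _]; congr EFin.
    have [_ symQ _ _] := sQ; apply: eq_bigr => i _; rewrite symQ//; first exact: Lu.
    exact: LQ.
  by apply: vec_ip_integrable => // i; exact/LQ/LQ.
have cth : continuous th by exact: Cn_continuous (sth 0%N).
have cdth : continuous (derive1 th).
  have [_ /(_ 1)[_]] := sth 1%N.
  move=> [+ _]; rewrite (_ : 'D_1 th = derive1 th)//.
  by apply/funext => x; rewrite derive1E.
have iH : (leb1 R).-integrable (segment T) (EFin \o H).
  apply: (integrable_EFinD (mseg T)).
    apply: (bounded_mul_integrable (c := 4 / k)) => //; first by rewrite divr_ge0// ltW.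
    exact: vec_ip_integrable.
  apply: (bounded_mul_integrable (c := 1)) => //.
    by move=> t; have /andP[? ?] := th01 t; rewrite ger0_norm.
  apply: (integrable_EFinD (mseg T)); last exact: icst.
  by apply: (integrable_EFinD (mseg T)) => //; exact: convection_integrable fM.
pose a := 2^-1 * m * S + 2 / k * F2.
pose g t := a + (M + 2 / k) * X t + 2^-1 * m^-1 * W t.
have iaX : (leb1 R).-integrable (segment T) (EFin \o (fun t => a + (M + 2 / k) * X t)).
  apply: (integrable_EFinD (mseg T)); first exact: icst.
  exact: (integrable_EFinZ (mseg T)).
have ig : (leb1 R).-integrable (segment T) (EFin \o g).
  by apply: (integrable_EFinD (mseg T)) => //; exact: (integrable_EFinZ (mseg T)).
(* On the plateau [J], [F2 * th] is at least [c]; elsewhere only its nonnegativity is kept. *)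
pose J : set (measurableTypeR R) := `[1 + k ^+ 2, T - k ^+ 2]%classic.
have mJ : measurable J by exact: measurable_itv.
pose c := F2 * (1 - 2 / k).
have iJ : (leb1 R).-integrable (segment T) (EFin \o (cst c \_ J)).
  apply: le_integrable_EFin (icst `|c|) => //.
    apply: measurable_funTS; exact/(measurable_restrictT _ mJ).
  by move=> t _; rewrite /patch; case: ifPn => // _; rewrite normr0.
have F20 : 0 <= F2 by exact: vec_sqnorm_ge0.
(* By definition of [H], [F2 th = H - th' p - th NL - th V], and [g] dominates the sum of the last
   three terms. This holds at almost every time, namely when [u(t)] has its weak gradient. *)
have main : {ae leb1 R, forall t, segment T t -> (cst c \_ J) t <= H t + g t}.
  apply: (@filterS _ _ (ae_filter_ringOfSetsType (leb1 R))) (ws_H1per ws) => t H1.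
  rewrite /= in_itv/= => /andP[t0 _].
  have yV := dissipative_young m0 t0 (H1 t0); rewrite -/(V t) in yV.
  have yN := convection_bound t0 fM.
  have yp : `|p t| <= 2^-1 * (X t + F2).
    by apply: vec_ip_young_abs => // i; exact: Lu.
  have /andP[th0 th1] := th01 t.
  have S0 : 0 <= S.
    rewrite addr_ge0// mulr_ge0 ?vec_sqnorm_ge0//; try exact: ltW.
    by apply: sumr_ge0 => i _; exact: vec_sqnorm_ge0.
  have W0 : 0 <= W t by rewrite addr_ge0// mulr_ge0 ?vec_sqnorm_ge0//; exact: ltW.
  have cth_le : (cst c \_ J) t <= F2 * th t.
    rewrite /patch; case: ifPn => [|_]; last exact: mulr_ge0.
    by rewrite mem_setE in_itv/= => /thge ?; rewrite ler_wpM2l.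
  have b1 : - (derive1 th t * p t) <= 2 / k * (X t + F2).
    apply: le_trans (ler_norm _) _; rewrite normrN normrM.
    apply: le_trans (ler_pM _ _ (dth t) yp) _ => //.
    by rewrite le_eqVlt; apply/orP; left; apply/eqP; field; rewrite gt_eqF.
  have b2 : - (th t * NL t) <= M * X t.
    apply: le_trans (ler_norm _) _; rewrite normrN normrM (ger0_norm th0).
    by apply: le_trans yN; rewrite ler_piMl.
  have b3 : - (th t * V t) <= 2^-1 * (m * S + m^-1 * W t).
    have rhs0 : 0 <= 2^-1 * (m * S + m^-1 * W t).
      by rewrite mulr_ge0// addr_ge0// mulr_ge0// ?invr_ge0 ltW.
    rewrite -mulrN; apply: le_trans (ler_wpM2l th0 yV) _.
    by rewrite ler_piMl.
  by apply: le_trans cth_le _; rewrite /g /a /H; lra.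
have := ae_le_Rintegral (mseg T) iJ (integrable_EFinD (mseg T) iH ig) main.
rewrite RintegralD// int_H add0r /g RintegralD//; last exact: (integrable_EFinZ (mseg T)).
rewrite RintegralD//; [|exact: icst|exact: (integrable_EFinZ (mseg T))].
rewrite !RintegralZl// Rintegral_cst// leb1_segment// -Rintegral_mkcondr.
rewrite Rintegral_cst//; last exact: measurableI.
rewrite (_ : segment T `&` J = J); last first.
  apply/setIidr => t; rewrite /J/= !in_itv/= => /andP[? ?].
  by have := sqr_ge0 k; lra.
suff -> : fine (leb1 R J) = T - 1 - 2 * k ^+ 2 by [].
rewrite /leb1 /J /= lebesgue_measure_itv /= lte_fin ifT; last by lra.
by rewrite -EFinB /=; ring.
Qed.

End WeakSolution.

(** * Limits superior at infinity *)

Section LimitSuperior.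
Context {R : realType}.
Implicit Type g : R -> \bar R.

Lemma limf_esup_le g (b : R) :
  (forall e, 0 < e -> \forall T \near +oo, (g T <= (b + e)%:E)%E) ->
  (limf_esup g +oo%R <= b%:E)%E.
Proof.
move=> gb; apply/lee_addgt0Pr => e e0; rewrite -EFinD limf_esupE.
apply: le_trans (ereal_inf_lbound _) _.
  by exists [set T | (g T <= (b + e)%:E)%E]; [exact: gb|reflexivity].
by apply: ge_ereal_sup => _ [T ? <-].
Qed.

Lemma limf_esup_lt_near g (b : \bar R) :
  (limf_esup g +oo%R < b)%E -> \forall T \near +oo, (g T <= b)%E.
Proof.
rewrite limf_esupE => /ereal_inf_lt[_ [V FV <-] Vb].
apply: filterS FV => T VT; apply: ltW; apply: le_lt_trans Vb.
by apply: ereal_sup_ubound; exists T.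
Qed.

End LimitSuperior.

(** * Elimination of the force from the two averaged inequalities *)

Section Averages.
Context {R : realType}.
Variables (E Y : R -> R) (c F L K : R).
Hypotheses (F0 : 0 < F) (L0 : 0 < L) (K0 : 0 <= K).
Hypothesis energy : forall T k, 0 < T -> 0 < k ->
  E T <= c / T + 2^-1 * (k * F ^+ 2 + k^-1 * Y T).

(** The case [U = 0], where the weight [U / F] degenerates. The energy inequality alone suffices:
    [k] is fixed small compared with [e], and [Y T] is then eventually small compared with [k e]. *)
Lemma average_vanish :
  (forall y, 0 < y -> \forall T \near +oo, Y T <= y) ->
  forall e, 0 < e -> \forall T \near +oo, E T <= e.
Proof.
move=> Y0 e e0; have F1 : 0 < F ^+ 2 + 1 by have := sqr_ge0 F; lra.
pose k := e / (F ^+ 2 + 1); have k0 : 0 < k by rewrite divr_gt0.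
near=> T.
have T0 : 0 < T by near: T; exact: nbhs_pinfty_gt.
apply: le_trans (energy T0 k0) _.
have cT : c / T <= e / 4.
  rewrite ler_pdivrMr// mulrC -ler_pdivrMr; last by lra.
  by near: T; apply: nbhs_pinfty_ge; rewrite num_real.
have YT : k^-1 * Y T <= e / 4.
  rewrite mulrC ler_pdivrMr//; near: T; apply: Y0.
  by rewrite mulr_gt0//; lra.
have : k * (F ^+ 2 + 1) = e by rewrite /k divfK// gt_eqF.
by lra.
Unshelve. all: by end_near. Qed.

Hypothesis forcing : forall T k m, 1 <= k -> 0 < m -> 1 + 2 * k ^+ 2 < T ->
  F ^+ 2 * (1 - 2 / k) * (1 - (1 + 2 * k ^+ 2) / T) <=
  2^-1 * m * F ^+ 2 * K + 2 / k * F ^+ 2 + (F / L + 2 / k) * Y T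
  + 2^-1 * m^-1 * E T.

(** The weight [q / F] makes [F q] the common quantity: up to errors the energy inequality reads
    [E <= F q], and the forcing inequality times [q / F] reads [F q <= q^2 K / 2 + q^3 / L + E / 2].
    Eliminating [F q] and doubling gives the claim. *)
Lemma forcing_energy_bound q k T : 0 < q -> 1 <= k -> 1 + 2 * k ^+ 2 < T ->
  Y T <= q ^+ 2 ->
  E T <= q ^+ 2 * K + 2 * q ^+ 3 / L + (8 * F * q + 4 * q ^+ 3 / F) / k
    + 2 * (c + F * q * (1 + 2 * k ^+ 2)) / T.
Proof.
move=> q0 k1 kT Yq; have k0 : 0 < k by rewrite (lt_le_trans ltr01).
have T0 : 0 < T by have := sqr_ge0 k; lra.
have m0 : 0 < q / F by rewrite divr_gt0.
have E1 : E T <= c / T + F * q.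
  apply: le_trans (energy T0 m0) _; rewrite lerD2l ler_pdivrMl//.
  have : (q / F)^-1 * Y T <= F * q.
    rewrite invf_div mulrAC ler_pdivrMr// -mulrA ler_pM2l//.
  rewrite (_ : q / F * F ^+ 2 = F * q); first by lra.
  by field; rewrite gt_eqF.
have := forcing k1 m0 kT.
rewrite -(ler_pM2l m0).
rewrite (_ : q / F * (F ^+ 2 * (1 - 2 / k) * (1 - (1 + 2 * k ^+ 2) / T)) =
  F * q - 2 * F * q / k - F * q * (1 + 2 * k ^+ 2) / T
   + 2 * F * q * (1 + 2 * k ^+ 2) / (k * T)); last first.
  by field; rewrite !gt_eqF.
rewrite (_ : q / F * _ = 2^-1 * q ^+ 2 * K + 2 * F * q / k + q / L * Y T
   + 2 * q / (F * k) * Y T + 2^-1 * E T); last first.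
  by field; rewrite !gt_eqF.
have h1 : q / L * Y T <= q ^+ 3 / L.
  rewrite exprSr mulrAC ler_pM2r ?invr_gt0// mulrC ler_pM2r//.
have h2 : 2 * q / (F * k) * Y T <= 2 * q ^+ 3 / (F * k).
  rewrite [leRHS](_ : _ = 2 * q / (F * k) * q ^+ 2); last by field; rewrite !gt_eqF.
  by rewrite ler_wpM2l// divr_ge0// mulr_ge0// ltW.
have h3 : 0 <= 2 * F * q * (1 + 2 * k ^+ 2) / (k * T).
  have k2 : 0 < 1 + 2 * k ^+ 2 by have := sqr_ge0 k; lra.
  by apply/ltW; rewrite divr_gt0 ?mulr_gt0.
rewrite (_ : (8 * F * q + 4 * q ^+ 3 / F) / k =
    4 * (2 * F * q / k) + 2 * (2 * q ^+ 3 / (F * k))); last first.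
  by field; rewrite !gt_eqF.
rewrite (_ : 2 * (c + F * q * (1 + 2 * k ^+ 2)) / T =
    2 * (c / T) + 2 * (F * q * (1 + 2 * k ^+ 2) / T)); last first.
  by field; rewrite !gt_eqF.
rewrite -(mulrA 2 (q ^+ 3)).
by move=> ?; lra.
Qed.

(** The limit superior bounds [Y T] eventually by [q^2] only for [q > r]. The passage from [r] to
    [q], the choice of [k] and the choice of [T] each cost [e / 3]; [T] comes last because its error
    grows with [k]. *)
Lemma average_bound r : 0 < r ->
  (forall y, r ^+ 2 < y -> \forall T \near +oo, Y T <= y) ->
  forall e, 0 < e -> \forall T \near +oo, E T <= r ^+ 2 * K + 2 * r ^+ 3 / L + e.
Proof.
move=> r0 Yr e e0.
(* Bounds the difference quotients from [r] of [q^2 K + 2 q^3 / L] for increments at most 1. *)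
pose C := K * (2 * r + 1) + 2 / L * (3 * r ^+ 2 + 3 * r + 1).
have C0 : 0 < C.
  have r2 : 0 < 3 * r ^+ 2 + 3 * r + 1 by have := sqr_ge0 r; lra.
  by rewrite ltr_wpDl ?mulr_ge0 ?mulr_gt0 ?invr_gt0//; lra.
pose s := Num.min 1 (e / 3 / C).
have s0 : 0 < s by rewrite lt_min ltr01/= !divr_gt0.
have s1 : s <= 1 by rewrite ge_min lexx.
have sC : s * C <= e / 3 by rewrite -ler_pdivlMr// ge_min lexx orbT.
pose q := r + s; have q0 : 0 < q by rewrite addr_gt0.
have qle : q ^+ 2 * K + 2 * q ^+ 3 / L <= r ^+ 2 * K + 2 * r ^+ 3 / L + e / 3.
  have h2 : q ^+ 2 - r ^+ 2 <= s * (2 * r + 1) by rewrite /q; nra.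
  have h3 : q ^+ 3 - r ^+ 3 <= s * (3 * r ^+ 2 + 3 * r + 1).
    rewrite (_ : q ^+ 3 - r ^+ 3 = s * (3 * r ^+ 2 + 3 * r * s + s ^+ 2)); last by rewrite /q; ring.
    by rewrite ler_pM2l//; nra.
  have := ler_wpM2l K0 h2.
  have L2 : 0 <= 2 / L by rewrite divr_ge0// ltW.
  have := ler_wpM2l L2 h3.
  by move: sC; rewrite /C; lra.
pose a := 8 * F * q + 4 * q ^+ 3 / F.
have a0 : 0 < a by rewrite addr_gt0 ?divr_gt0 ?mulr_gt0 ?exprn_gt0.
pose k := Num.max 1 (3 * a / e).
have k1 : 1 <= k by rewrite le_max lexx.
have k0 : 0 < k by rewrite (lt_le_trans ltr01).
have ak : a / k <= e / 3.
  rewrite ler_pdivrMr//; have : 3 * a / e <= k by rewrite le_max lexx orbT.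
  rewrite ler_pdivrMr//; lra.
pose b := 2 * (c + F * q * (1 + 2 * k ^+ 2)).
near=> T.
have kT : 1 + 2 * k ^+ 2 < T by near: T; apply: nbhs_pinfty_gt; rewrite num_real.
have T0 : 0 < T by have := sqr_ge0 k; lra.
have Yq : Y T <= q ^+ 2.
  near: T; apply: Yr; rewrite ltrXn2r// ?nnegrE ?ltW// /q; lra.
have bT : b / T <= e / 3.
  rewrite ler_pdivrMr// mulrC -ler_pdivrMr; last by lra.
  by near: T; apply: nbhs_pinfty_ge; rewrite num_real.
have := forcing_energy_bound q0 k1 kT Yq; rewrite -/a -/b; lra.
Unshelve. all: by end_near. Qed.

End Averages.

(** * The scaling of [B] and the entries of the length scale *)

Lemma scaled_sqrt_sqnorm (R : realType) (l delta : R) N Q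
    (v : 'I_3 -> R * R * R -> R) : 0 < delta -> (forall i, L2per l (Q (v i))) ->
  delta ^+ (2 * N + 2) * vec_sqnorm l (fun i => scaled_sqrt delta N Q (v i)) =
  vec_sqnorm l (fun i => Q (v i)).
Proof.
move=> d0 LQ; rewrite /vec_sqnorm /vec_ip mulr_sumr; apply: eq_bigr => i _.
have LZ := L2perZ (delta ^- N.+1) (LQ i).
rewrite box_ipZl// box_ipZr// !mulrA (_ : (2 * N + 2 = N.+1 + N.+1)%N); last by lia.
have dn : delta ^+ N.+1 != 0 by rewrite expf_neq0// gt_eqF.
by rewrite exprD mulfK// divff// mul1r.
Qed.

Section LengthScale.
Context {R : realType} (l : R) (N : nat) (B : (R * R * R -> R) -> R * R * R -> R)
  (f : 'I_3 -> R * R * R -> R).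
Hypothesis l0 : 0 < l.

Local Notation F := (force_scale l f).
Local Notation L := (length_scale l N B f).
Local Notation vol := ((l ^+ 3)^-1).

Let vol0 : 0 < vol.
Proof. by rewrite invr_gt0 exprn_gt0. Qed.

Let F_ge0 : 0 <= F.
Proof. exact: sqrtr_ge0. Qed.

Lemma length_scale_ge0 : 0 <= L.
Proof.
rewrite /length_scale !le_min powR_ge0 !divr_ge0 ?sqrtr_ge0 ?powR_ge0//=.
by rewrite fine_ge0 ?Lnorm_ge0.
Qed.

Lemma force_scale_sqr : F ^+ 2 = vol * vec_sqnorm l f.
Proof. by rewrite sqr_sqrtr// mulr_ge0 ?vec_sqnorm_ge0// ltW. Qed.

Hypothesis L0 : 0 < L.

Let L_le : [/\ L <= F / Num.sqrt (vol * ten_sqnorm l (gradient f)),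
  L <= F / fine 'N[leb3 R]_+oo[EFin \o (frobenius (gradient f) \_ (box l))] &
  L <= F `^ N.+1%:R^-1 / (vol * vec_sqnorm l (fun i => B (f i))) `^ (2 * N + 2)%:R^-1].
Proof.
by split; rewrite /length_scale !ge_min lexx ?orbT.
Qed.

(** Because [x / 0 = 0], a positive lower bound on [a / b] excludes [b = 0], and then
    [a = (a / b) b] is positive. *)
Let quotient_le (a b : R) : 0 <= a -> 0 <= b -> L <= a / b -> 0 < a /\ L * b <= a.
Proof.
move=> a0 b0 Lab; have ab : 0 < a / b by exact: lt_le_trans Lab.
have b1 : 0 < b.
  rewrite lt_neqAle b0 andbT; apply: contraTneq ab => <-.
  by rewrite invr0 mulr0 ltxx.
split; last by rewrite -ler_pdivlMr.
by rewrite -(divfK (lt0r_neq0 b1) a) mulr_gt0.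
Qed.

Lemma length_scale_force_gt0 : 0 < F.
Proof. by have [+ _ _] := L_le => /quotient_le[]//; rewrite sqrtr_ge0. Qed.

Lemma length_scale_gradient_le :
  vol * ten_sqnorm l (gradient f) <= F ^+ 2 / L ^+ 2.
Proof.
have ten0 : 0 <= vol * ten_sqnorm l (gradient f).
  apply: mulr_ge0; first exact: ltW.
  by apply: sumr_ge0 => i _; exact: vec_sqnorm_ge0.
have [+ _ _] := L_le => /quotient_le[]; rewrite ?sqrtr_ge0//.
move=> _ h; rewrite ler_pdivlMr ?exprn_gt0// mulrC -[X in _ * X]sqr_sqrtr// -exprMn.
by rewrite lerXn2r ?nnegrE// mulr_ge0 ?sqrtr_ge0 ?length_scale_ge0.
Qed.

Lemma length_scale_frobenius_le :
  {ae leb3 R, forall x, box l x -> frobenius (gradient f) x <= F / L}.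
Proof.
set g := EFin \o (frobenius (gradient f) \_ (box l)).
have [_ + _] := L_le; rewrite -/g => Lg.
have fN0 : 0 <= fine ('N[leb3 R]_+oo[g]) by rewrite fine_ge0 ?Lnorm_ge0.
have [_ LF] := quotient_le F_ge0 fN0 Lg.
(* Since [fine] sends [+oo] to 0, positivity of the real norm also shows that the essential supremum
   is finite. *)
have fN_gt0 : 0 < fine ('N[leb3 R]_+oo[g]).
  rewrite lt_neqAle fN0 andbT; apply: contraTneq (lt_le_trans L0 Lg) => <-.
  by rewrite invr0 mulr0 ltxx.
have NF : ('N[leb3 R]_+oo[g] <= (F / L)%:E)%E.
  move: fN_gt0 LF; case: ('N[leb3 R]_+oo[g])%E => [r||]//=; rewrite ?ltxx// => _ h.
  by rewrite lee_fin ler_pdivlMr// mulrC.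
move: NF; rewrite unlock /Lnorm/=; case: ifPn => [_ /ess_supP H|].
  apply: (@filterS _ _ (ae_filter_ringOfSetsType (leb3 R))) H => x + bx.
  by rewrite /g/= patchE mem_set// lee_fin ger0_norm// sqrtr_ge0.
(* The other branch in the definition of the norm, for a space of measure 0, where every property
   holds almost everywhere. *)
rewrite -leNgt measure_le0 => /eqP mu0 _.
exists setT; split=> //.
Qed.

(** The inequality [L b^(1/(2N+2)) <= F^(1/(N+1))] raised to the power [2N+2], which is twice [N+1],
    whence [F^2]. *)
Lemma length_scale_B_le :
  vol * vec_sqnorm l (fun i => B (f i)) <= F ^+ 2 / L ^+ (2 * N + 2).
Proof.
have b0 : 0 <= vol * vec_sqnorm l (fun i => B (f i)).
  by rewrite mulr_ge0 ?vec_sqnorm_ge0// ltW.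
have [_ _ +] := L_le => /quotient_le[]; rewrite ?powR_ge0// => _ h.
rewrite ler_pdivlMr ?exprn_gt0//.
have n0 : (0 <= (2 * N + 2)%:R :> R) by [].
have := @ge0_ler_powR R _ n0 _ _ _ _ h; rewrite !nnegrE powR_ge0.
rewrite mulr_ge0 ?powR_ge0 ?length_scale_ge0// => /(_ isT isT).
rewrite powRM ?powR_ge0 ?length_scale_ge0// -!powRrM.
have n1 : (2 * N + 2)%:R != 0 :> R by rewrite pnatr_eq0 addn2.
rewrite (mulVf n1) (powRr1 b0) mulrC.
rewrite powR_mulrn ?length_scale_ge0// (_ : N.+1%:R^-1 * _ = 2).
  by rewrite (powR_mulrn 2) // mulrC.
rewrite (_ : (2 * N + 2 = N.+1 * 2)%N); last by lia.
by rewrite natrM mulKf// pnatr_eq0.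
Qed.

End LengthScale.

(** * Assembly of the final estimate *)

(** For positive reals, extended division agrees with real division, and the terms [1 / Re] and
    [1 / RN] times [U^3 / L] become [nu U^2 / L^2] and [a U^2 / L^(2n+2)]. *)
Lemma reynolds_bound_EFin (R : realType) (r L nu a : R) (n : nat) :
  0 < r -> 0 < L -> 0 < nu -> 0 < a ->
  ((2%:E + 1 / (r%:E * L%:E / nu%:E)
      + 1 / (r%:E * (L ^+ (2 * n + 1))%:E / a%:E)) * (r%:E ^+ 3 / L%:E))%E =
  (r ^+ 2 * (nu / L ^+ 2 + a / L ^+ (2 * n + 2)) + 2 * r ^+ 3 / L)%:E.
Proof.
move=> r0 L0 nu0 a0; rewrite (_ : (2 * n + 2 = (2 * n + 1).+1)%N); last by lia.
set q := L ^+ (2 * n + 1); have q0 : 0 < q by exact: exprn_gt0.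
have inv (x : R) : 0 < x -> (x%:E^-1 = x^-1%:E)%E by move=> x0; rewrite inver gt_eqF.
rewrite !mul1e (inv nu)// (inv L)// (inv a)// -EFin_expe -!EFinM.
rewrite (inv (r * L / nu)); last by rewrite divr_gt0// mulr_gt0.
rewrite (inv (r * q / a)); last by rewrite divr_gt0// mulr_gt0.
rewrite -!EFinD -EFinM (exprS L (2 * n + 1)) -/q; congr EFin.
by field; rewrite !gt_eqF.
Qed.

Theorem theorem3p1 (R : realType) (l nu chi delta : R) (N : nat)
    (G Q : (R * R * R -> R) -> R * R * R -> R)
    (u0 f : 'I_3 -> R * R * R -> R)
    (u : R -> 'I_3 -> R * R * R -> R)
    (Du : R -> 'I_3 -> 'I_3 -> R * R * R -> R) :
  0 < l -> 0 < nu -> 0 < chi -> 0 < delta ->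
  is_filter l delta G ->
  is_sqrt_op l (residual G N) Q ->
  smooth_data l u0 -> smooth_data l f ->
  (exists i x, f i x <> 0) ->
  weak_solution l nu chi (residual G N) u0 f u Du ->
  let B := scaled_sqrt delta N Q in
  let U := velocity_scale l u in
  let L := length_scale l N B f in
  let Re := (U * L%:E / nu%:E)%E in
  let RN := (U * (L ^+ (2 * N + 1))%:E / (chi * delta ^+ (2 * N + 2))%:E)%E in
  (time_average (fun t => dissipation l nu chi delta N B (u t) (Du t))
   <= (2%:E + 1 / Re + 1 / RN) * (U ^+ 3 / L%:E))%E.
Proof.
move=> l0 nu0 chi0 d0 GF sQ du0 df _ ws; cbv zeta.
set B := scaled_sqrt delta N Q; set U := velocity_scale l u.
set L := length_scale l N B f; set Re := (U * L%:E / nu%:E)%E.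
set RN := (U * (L ^+ (2 * N + 1))%:E / _)%E.
have bA := residual_L2bounded N GF.
have LQ g : L2per l g -> L2per l (Q g) by have [H _ _ _] := sQ; exact: H.
have Lu t i : 0 <= t -> L2per l (u t i) by move=> t0; exact: (ws_L2per ws).
have Lf i : L2per l (f i) by case: df => sf pf _ _; exact: smooth_L2per.
pose vol := (l ^+ 3)^-1; have vol0 : 0 < vol by rewrite invr_gt0 exprn_gt0.
pose X t := vec_sqnorm l (u t).
pose W t := nu * ten_sqnorm l (Du t) + chi * vec_sqnorm l (fun i => Q (u t i)).
pose Y T := T^-1 * (vol * \int[leb1 R]_(t in `[0, T]) X t).
pose E T := T^-1 * (vol * \int[leb1 R]_(t in `[0, T]) W t).
pose F := force_scale l f.
have F2 : F ^+ 2 = vol * vec_sqnorm l f by exact: force_scale_sqr.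
have average_EFin (Z psi : R -> R) T : 0 < T ->
    (leb1 R).-integrable `[0, T] (EFin \o Z) ->
    (forall t, 0 <= t -> psi t = vol * Z t) ->
    (T^-1%:E * \int[leb1 R]_(t in `[0%R, T]) (psi t)%:E =
     (T^-1 * (vol * \int[leb1 R]_(t in `[0, T]) Z t))%:E)%E.
  move=> T0 iZ psiE; have mT : measurable (`[0, T]%classic : set (measurableTypeR R)).
    exact: measurable_itv.
  rewrite EFinM -RintegralZl// EFin_Rintegral//; last exact: integrable_EFinZ.
  congr (_ * _)%E; apply: eq_integral => t; rewrite inE/= in_itv/= => /andP[t0 _].
  by rewrite psiE.
have EE T : 0 < T -> (T^-1%:E * \int[leb1 R]_(t in `[0%R, T])
    (dissipation l nu chi delta N B (u t) (Du t))%:E = (E T)%:E)%E.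
  move=> T0; apply: (average_EFin W) => //; first exact: dissipation_integrable bA sQ ws _ T0.
  move=> t t0; rewrite /dissipation -mulrA /B scaled_sqrt_sqnorm// => i.
  exact/LQ/Lu.
have YE T : 0 < T -> (T^-1%:E * \int[leb1 R]_(t in `[0%R, T])
    ((l ^+ 3)^-1 * vec_sqnorm l (u t))%:E = (Y T)%:E)%E.
  by move=> T0; apply: (average_EFin X) => //; exact: velocity_sqnorm_integrable ws _ T0.
pose c := vol * (2^-1 * vec_sqnorm l u0).
have energy T k : 0 < T -> 0 < k ->
    E T <= c / T + 2^-1 * (k * F ^+ 2 + k^-1 * Y T).
  move=> T0 k0; have volT : 0 <= T^-1 * vol by apply/ltW; rewrite mulr_gt0// invr_gt0.
  rewrite {1}/E mulrA.
  apply: le_trans (ler_wpM2l volT (energy_bound bA sQ df ws T0 k0)) _.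
  rewrite F2 /Y /c le_eqVlt; apply/orP; left.
  by apply/eqP; field; rewrite !gt_eqF.
have near_gt0 : \forall T \near (+oo : set_system R), 0 < T by exact: nbhs_pinfty_gt.
have L_ge0 : 0 <= L by exact: length_scale_ge0.
have U_ge0 : (0 <= U)%E by exact: sqrte_ge0.
(* Strict positivity is what makes the right-hand side infinite as soon as [U^3 / L] is. *)
have coef_gt0 : (0 < 2%:E + 1 / Re + 1 / RN)%E.
  apply: (@lt_le_trans _ _ 2%:E) => //; rewrite -addeA leeDl//.
  rewrite !div1e; apply: adde_ge0; rewrite inve_ge0; apply: mule_ge0; rewrite ?inve_ge0 ?lee_fin.
  - by rewrite mule_ge0// lee_fin.
  - exact: ltW.
  - by rewrite mule_ge0// lee_fin exprn_ge0.
  - by apply/ltW; rewrite mulr_gt0 ?exprn_gt0.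
have infinite : (U ^+ 3 / L%:E = +oo)%E ->
    (time_average (fun t => dissipation l nu chi delta N B (u t) (Du t)) <=
     (2%:E + 1 / Re + 1 / RN) * (U ^+ 3 / L%:E))%E.
  by move=> ->; rewrite gt0_muley// leey.
have [U_oo|[r Ur]] : U = +oo%E \/ exists r, U = r%:E.
  by rewrite /U /velocity_scale; case: time_average => [a||]/=; [right|left|right]; eexists.
  apply: infinite; rewrite U_oo expeS expe2 !mulyy.
  have [->|L_neq0] := eqVneq L 0; first by rewrite inve0 mulyy.
  by rewrite inver (negbTE L_neq0) gt0_mulye// lte_fin invr_gt0 lt_neqAle eq_sym L_neq0.
have r_ge0 : 0 <= r by rewrite -lee_fin -Ur.
have Yr y : r ^+ 2 < y -> \forall T \near +oo, Y T <= y.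
  move=> ry; have /limf_esup_lt_near H : (time_average
      (fun t => ((l ^+ 3)^-1 * vec_sqnorm l (u t))%R) < y%:E)%E.
    (* The extended square root sends negative values to 0; a negative limit superior, or [-oo], is
       compared directly with [0 <= r^2 < y]. *)
    move: Ur; rewrite /U /velocity_scale; case: time_average => [a||]//=.
      move=> [ra]; rewrite lte_fin; have [a0|a0] := leP 0 a.
        by rewrite -(sqr_sqrtr a0) ra.
      by rewrite (lt_trans a0)// (le_lt_trans _ ry)// sqr_ge0.
    by rewrite ltNyr.
  near=> T; have T0 : 0 < T by near: T.
  by rewrite -lee_fin -YE//; near: T.
(* For [U = 0] both [1 / Re] and [1 / RN] are [+oo], but [+oo * 0 = 0]: the bound to prove is 0, for
   every value of [L]. *)
have [r_eq0|r_neq0] := eqVneq r 0.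
  rewrite Ur r_eq0 expeS mul0e mul0e mule0; apply: limf_esup_le => e e0.
  have Y0 y : 0 < y -> \forall T \near +oo, Y T <= y.
    by move=> y0; apply: Yr; rewrite r_eq0 expr0n.
  have H := average_vanish energy Y0 e0.
  near=> T; have T0 : 0 < T by near: T.
  by rewrite EE// lee_fin add0r; near: T.
have r0 : 0 < r by rewrite lt_neqAle eq_sym r_neq0.
(* L vanishes when one of its denominators does, since x / 0 = 0 in R; the bound
   is then infinite, since x / 0 = +oo in \bar R for x > 0. *)
have [L_eq0|L_neq0] := eqVneq L 0.
  by apply: infinite; rewrite L_eq0 inve0 Ur -EFin_expe gt0_muley// lte_fin exprn_gt0.
have L0 : 0 < L by rewrite lt_neqAle eq_sym L_neq0.
have F0 : 0 < F by exact: length_scale_force_gt0 L0.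
pose K := nu / L ^+ 2 + chi * delta ^+ (2 * N + 2) / L ^+ (2 * N + 2).
have K0 : 0 <= K.
  by apply/ltW; rewrite addr_gt0// divr_gt0// ?mulr_gt0// exprn_gt0.
pose S := nu * ten_sqnorm l (gradient f) + chi * vec_sqnorm l (fun i => Q (f i)).
(* The second and fourth entries of the minimum defining [L] bound the dissipation of [f]; the third
   gives the convection bound [M = F / L] below. *)
have volS : vol * S <= F ^+ 2 * K.
  have h1 := ler_wpM2l (ltW nu0) (length_scale_gradient_le l0 L0).
  have h2 : 0 <= chi * delta ^+ (2 * N + 2) by apply/ltW; rewrite mulr_gt0 ?exprn_gt0.
  have := ler_wpM2l h2 (length_scale_B_le l0 L0).
  rewrite /S -(scaled_sqrt_sqnorm N d0 (fun i => LQ _ (Lf i))) -/B -/vol -/F -/L.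
  move: h1; rewrite -/vol -/F -/L /K; lra.
have forcing T k m : 1 <= k -> 0 < m -> 1 + 2 * k ^+ 2 < T ->
    F ^+ 2 * (1 - 2 / k) * (1 - (1 + 2 * k ^+ 2) / T) <=
    2^-1 * m * F ^+ 2 * K + 2 / k * F ^+ 2 + (F / L + 2 / k) * Y T
    + 2^-1 * m^-1 * E T.
  move=> k1 m0 kT; have T0 : 0 < T by have := sqr_ge0 k; lra.
  have k0 : 0 < k by rewrite (lt_le_trans ltr01).
  have volT : 0 <= T^-1 * vol by apply/ltW; rewrite mulr_gt0// invr_gt0.
  have := ler_wpM2l volT (forcing_bound nu0 chi0 bA sQ df ws k1 m0 kT
    (length_scale_frobenius_le L0)).
  rewrite -/F -/L -/S -/X -/W.
  rewrite [leLHS](_ : _ = F ^+ 2 * (1 - 2 / k) * (1 - (1 + 2 * k ^+ 2) / T)); last first.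
    by rewrite F2; field; rewrite !gt_eqF.
  move=> /le_trans; apply.
  have := ler_wpM2l (ltW m0) volS.
  rewrite [leLHS in _ -> leLHS <= _](_ : _ = 2^-1 * (m * (vol * S)) + 2 / k * F ^+ 2
    + (F / L + 2 / k) * Y T + 2^-1 * m^-1 * E T); first by lra.
  by rewrite F2 /Y /E; field; rewrite !gt_eqF.
rewrite (_ : (_ * _)%E = (r ^+ 2 * K + 2 * r ^+ 3 / L)%:E).
  apply: limf_esup_le => e e0.
  have H := average_bound F0 L0 K0 energy forcing r0 Yr e0.
  near=> T; have T0 : 0 < T by near: T.
  by rewrite EE// lee_fin; near: T.
rewrite /Re /RN Ur; apply: reynolds_bound_EFin => //.
by rewrite mulr_gt0// exprn_gt0.
Unshelve. all: by end_near. Qed.
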